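(* There is a polynomial-time algorithm that, given a graph $G=(V,E)$ with weight function $w\colon V\to\mathbb{Q}_{\ge0}$, computes a vertex cover of weight at most $\mathrm{OPT}_{\mathrm{WVC}}(G,w)+\mathrm{OPT}_{\mathrm{CVD}}(G,w)$.
   Context: A vertex cover is a set $X\subseteq V$ with $G-X$ edgeless; its weight is $w(X)=\sum_{x\in X}w(x)$, and $\mathrm{OPT}_{\mathrm{WVC}}(G,w)$ is the minimum weight of a vertex cover. A cluster graph is a graph in which every connected component is a clique (equivalently, no induced path on three vertices). $\mathrm{OPT}_{\mathrm{CVD}}(G,w)$ is the minimum weight $w(M)$ of a set $M\subseteq V$ such that $G-M$ is a cluster graph. *)

(* Defs.v *)
From HB Require Import structures.
From mathcomp Require Import all_boot all_order all_algebra.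

Set Implicit Arguments.
Unset Strict Implicit.
Unset Printing Implicit Defensive.

Import Order.TTheory GRing.Theory Num.Theory.
Local Open Scope ring_scope.

(* Machine model: a structured WHILE language whose variables hold binary     *)
(* trees with integer leaves. Time is charged by bit size (logarithmic cost): *)
(* evaluating an expression costs the total size of the values of all its     *)
(* subexpressions, so every operand and every result is paid for in full and  *)
(* the model is polynomially equivalent to Turing machines.                   *)

Inductive data : Type :=
| Atom of int
| Node of data & data.

(* Length in binary, plus one for the sign; trunc_log 2 0 is 0. *)
Definition bitsize (z : int) : nat := (trunc_log 2 `|z|%N).+2.

Fixpoint dsize (d : data) : nat :=
  match d with
  | Atom z => bitsize z
  | Node a b => (dsize a + dsize b).+1
  end.

Inductive expr : Type :=
| EVar of nat
| ECst of int
| ENode of expr & expr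
| EFst of expr
| ESnd of expr
| EIsAtom of expr
| EAdd of expr & expr
| ESub of expr & expr
| EMul of expr & expr
| ELe of expr & expr.

Inductive cmd : Type :=
| CSkip
| CSet of nat & expr
| CSeq of cmd & cmd
| CIf of expr & cmd & cmd
| CWhile of expr & cmd.

Definition store := nat -> data.

Definition upd (s : store) (x : nat) (d : data) : store :=
  fun y => if y == x then d else s y.

(* Ill-typed operations are total: a Node counts as the integer 0, and the    *)
(* projections of an Atom are Atom 0.                                         *)
Definition to_int (d : data) : int := if d is Atom z then z else 0.
Definition dfst (d : data) : data := if d is Node a _ then a else Atom 0.
Definition dsnd (d : data) : data := if d is Node _ b then b else Atom 0.
Definition of_bool (b : bool) : data := Atom (b : nat)%:Z.
Definition truth (d : data) : bool := if d is Atom z then z != 0 else true.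

Fixpoint eval (s : store) (e : expr) : data :=
  match e with
  | EVar x => s x
  | ECst z => Atom z
  | ENode a b => Node (eval s a) (eval s b)
  | EFst a => dfst (eval s a)
  | ESnd a => dsnd (eval s a)
  | EIsAtom a => of_bool (if eval s a is Atom _ then true else false)
  | EAdd a b => Atom (to_int (eval s a) + to_int (eval s b))
  | ESub a b => Atom (to_int (eval s a) - to_int (eval s b))
  | EMul a b => Atom (to_int (eval s a) * to_int (eval s b))
  | ELe a b => of_bool (to_int (eval s a) <= to_int (eval s b))
  end.

Fixpoint cost (s : store) (e : expr) : nat :=
  (dsize (eval s e) +
   match e with
   | EVar _ | ECst _ => 0
   | EFst a | ESnd a | EIsAtom a => cost s a
   | ENode a b | EAdd a b | ESub a b | EMul a b | ELe a b => cost s a + cost s b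
   end)%N.

(* exec c s t s' : started in s, the program c halts in s' after time t.      *)
Inductive exec : cmd -> store -> nat -> store -> Prop :=
| exec_skip s : exec CSkip s 1 s
| exec_set s x e : exec (CSet x e) s (cost s e).+1 (upd s x (eval s e))
| exec_seq c1 c2 s1 s2 s3 t1 t2 :
    exec c1 s1 t1 s2 -> exec c2 s2 t2 s3 ->
    exec (CSeq c1 c2) s1 (t1 + t2).+1 s3
| exec_if e c1 c2 s s' t :
    exec (if truth (eval s e) then c1 else c2) s t s' ->
    exec (CIf e c1 c2) s (cost s e + t).+1 s'
| exec_while_stop e c s :
    ~~ truth (eval s e) -> exec (CWhile e c) s (cost s e).+1 s
| exec_while_step e c s1 s2 s3 t1 t2 :
    truth (eval s1 e) -> exec c s1 t1 s2 -> exec (CWhile e c) s2 t2 s3 ->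
    exec (CWhile e c) s1 (cost s1 e + t1 + t2).+1 s3.

(* Variable 0 holds the input at the start and the output at the end.         *)
Definition init (input : data) : store :=
  fun x => if x == 0%N then input else Atom 0.

Definition outputs_within (c : cmd) (input output : data) (bound : nat) : Prop :=
  exists t s, [/\ exec c (init input) t s, s 0%N = output & (t <= bound)%N].

Lemma exec_deterministic c s t1 s1 t2 s2 :
  exec c s t1 s1 -> exec c s t2 s2 -> t1 = t2 /\ s1 = s2.
Proof.
move=> H; elim: H t2 s2 => {c s t1 s1}.
- by move=> s t2 s2 H; inversion H.
- by move=> s x e t2 s2 H; inversion H.
- move=> c1 c2 s1 s2 s3 t1 t2 _ IH1 _ IH2 t s H; inversion H as [| |? ? ? ? ? ? ? K1 K2| | |]; subst.
  by case: (IH1 _ _ K1) => ? ?; subst; case: (IH2 _ _ K2) => -> ->.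
- move=> e c1 c2 s s' t _ IH t2 s2 H; inversion H as [| | |? ? ? ? ? ? K| |]; subst.
  by case: (IH _ _ K) => -> ->.
- move=> e c s Hn t2 s2 H.
  by inversion H as [| | | | |? ? ? ? ? ? ? K]; subst=> //; rewrite K in Hn.
- move=> e c s1 s2 s3 t1 t2 Ht _ IH1 _ IH2 t s H.
  inversion H as [| | | |? ? ? K|? ? ? ? ? ? ? K K1 K2]; subst; first by rewrite Ht in K.
  by case: (IH1 _ _ K1) => ? ?; subst; case: (IH2 _ _ K2) => -> ->.
Qed.

(* G - X, keeping the deleted vertices as isolated points: this affects       *)
(* neither edgelessness nor being a cluster graph.                            *)
Definition delete (V : finType) (e : rel V) (X : {set V}) : rel V :=
  [rel x y | [&& x \notin X, y \notin X & e x y]].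

Definition edgeless (V : finType) (e : rel V) : bool :=
  [forall x, forall y, ~~ e x y].

Definition cluster_graph (V : finType) (e : rel V) : bool :=
  [forall x, forall y, connect e x y ==> (x != y) ==> e x y].

Definition vertex_cover (V : finType) (e : rel V) (X : {set V}) : bool :=
  edgeless (delete e X).

Definition cluster_deletion (V : finType) (e : rel V) (M : {set V}) : bool :=
  cluster_graph (delete e M).

Definition weight (V : finType) (w : V -> rat) (X : {set V}) : rat :=
  \sum_(x in X) w x.

Definition OPT_WVC (V : finType) (e : rel V) (w : V -> rat) : rat :=
  weight w [arg min_(X < setT | vertex_cover e X) weight w X]%O.

Definition OPT_CVD (V : finType) (e : rel V) (w : V -> rat) : rat :=
  weight w [arg min_(M < setT | cluster_deletion e M) weight w M]%O.

(* setT is feasible for both problems, so the arg min above is never the      *)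
(* fallback value.                                                            *)
Lemma vertex_coverT (V : finType) (e : rel V) : vertex_cover e setT.
Proof. by apply/forallP=> x; apply/forallP=> y; rewrite /delete /= in_setT. Qed.

Lemma cluster_deletionT (V : finType) (e : rel V) : cluster_deletion e setT.
Proof.
apply/forallP=> x; apply/forallP=> y.
apply/implyP => /connectP[[|z p]]; last by rewrite /= /delete /= in_setT.
by move=> _ /= ->; rewrite eqxx.
Qed.

Definition enc_seq (l : seq data) : data := foldr Node (Atom 0) l.

Definition enc_rat (q : rat) : data := Node (Atom (numq q)) (Atom (denq q)).

Definition enc_set n (X : {set 'I_n}) : data :=
  enc_seq [seq of_bool (x \in X) | x <- enum 'I_n].

(* The list of weights (fractions in lowest terms), then the adjacency matrix *)
(* row by row.                                                                *)
Definition enc_graph n (e : rel 'I_n) (w : 'I_n -> rat) : data :=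
  Node (enc_seq [seq enc_rat (w x) | x <- enum 'I_n])
       (enc_seq [seq enc_set [set y | e x y] | x <- enum 'I_n]).

(* Main.v *)
Require Import Defs.
From HB Require Import structures.
From mathcomp Require Import all_boot all_order all_algebra.
From mathcomp Require Import zify.

(* Local ratio. Let v have a nonempty set N of neighbours of positive weight,  *)
(* and split N greedily into k cliques, each maximal in what the previous ones *)
(* leave. Put weight k on v and 1 on each member of N. A vertex cover avoiding *)
(* v contains N, and one containing v misses at most one vertex of each of the *)
(* k cliques, so it weighs at least |N|. A cluster deletion set avoiding v     *)
(* leaves a clique of N, and by maximality a clique misses at least k - 1      *)
(* vertices of N, so it weighs at least k - 1. Hence the two optima add up to  *)
(* at least |N| + k - 1, which every set not containing all of v and N         *)
(* respects. So one may subtract the largest possible multiple of this weight  *)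
(* until the positive vertices are independent; the null vertices then form a  *)
(* cover, and dropping the centres v from it in reverse order, whenever all    *)
(* their neighbours are in it, makes it miss v or a vertex of N for every      *)
(* subtracted star.                                                            *)
(* Weights are kept integral: they are first multiplied by all denominators,   *)
(* and by k before each subtraction, so they grow by O(log n) bits per step.   *)

Set Implicit Arguments.
Unset Strict Implicit.
Unset Printing Implicit Defensive.

Import Order.TTheory GRing.Theory Num.Theory.
Local Open Scope ring_scope.
Local Open Scope nat_scope.

(** * Polynomial-time functions on data *)

(** Correctness is a local-ratio induction run backwards. For one star the three estimates
    [star_vertex_cover], [star_cluster_deletion] and [star_upper] say that a set missing some vertex
    of the star has star weight at most that of any cover [C] plus that of any deletion set [M].
    Weight being additive, an inequality w(X) <= w(C) + w(M) for the reduced weights therefore lifts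
    to the weights before the reduction, once pruning makes X miss the centre or a leaf; this is the
    last clause of [reduce_at_props]. Every step annihilates a new vertex, so [#|V|] steps suffice
    ([reduce_sound]). At the end the null vertices form a cover of weight 0, and [reduce_final]
    unwinds the stack. Comparing with all [C] and [M] at once avoids any mention of optima until the
    very end.

    For the running time, functions on trees computed in polynomial time are shown closed under
    composition, pairing, branching and folds, the last under a size bound on the accumulators
    ([polytime_fold]). The algorithm is then written as a function [dwvc] from these constructions,
    and [dwvcE] identifies it with the abstract algorithm. Only the main loop needs a global size
    bound: a step multiplies weights by at most [n], so bit sizes grow additively
    ([bitsize_state]). *)

Lemma bitsize_ge2 z : 2 <= bitsize z.
Proof. by []. Qed.

Lemma dsize_ge2 d : 2 <= dsize d.
Proof. by elim: d => [z|a IHa b IHb] //=; lia. Qed.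

Lemma bitsize_le (z : int) b : `|z|%N < 2 ^ b.+1 -> bitsize z <= b.+2.
Proof.
move=> H; rewrite /bitsize !ltnS.
case: (posnP `|z|%N) => [-> | z0]; first by rewrite trunc_log0.
by rewrite -ltnS -(ltn_exp2l _ _ (ltnSn 1)); apply: leq_ltn_trans H; apply: trunc_logP.
Qed.

Lemma bitsize_gt (z : int) : `|z|%N < 2 ^ (bitsize z).-1.
Proof. by rewrite /bitsize /=; apply: trunc_log_ltn. Qed.

(** Crude for a sum, but it gives addition and multiplication the same bound, the one that
    [polytime_set2] asks of binary operators. *)
Lemma bitsizeD a b : bitsize (a + b)%R <= bitsize a + bitsize b.
Proof.
have Ha := bitsize_gt a; have Hb := bitsize_gt b.
have ge_a := bitsize_ge2 a; have ge_b := bitsize_ge2 b.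
have -> : bitsize a + bitsize b = (bitsize a + bitsize b - 2).+2 by lia.
apply: bitsize_le.
have E : 2 ^ (bitsize a + bitsize b - 2).+1 = 2 ^ (bitsize a).-1 * 2 ^ (bitsize b).-1 * 2.
  by rewrite -expnD -expnSr; congr (_ ^ _); lia.
rewrite E; have : `|(a + b)%R| <= `|a| + `|b| by lia.
move: (2 ^ _) (2 ^ _) Ha Hb => x y; nia.
Qed.

Lemma bitsizeM a b : bitsize (a * b)%R <= bitsize a + bitsize b.
Proof.
have Ha := bitsize_gt a; have Hb := bitsize_gt b.
have ge_a := bitsize_ge2 a; have ge_b := bitsize_ge2 b.
have -> : bitsize a + bitsize b = (bitsize a + bitsize b - 2).+2 by lia.
apply: bitsize_le; rewrite abszM.
have E : 2 ^ (bitsize a + bitsize b - 2).+1 = 2 ^ (bitsize a).-1 * 2 ^ (bitsize b).-1 * 2.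
  by rewrite -expnD -expnSr; congr (_ ^ _); lia.
rewrite E; move: (2 ^ _) (2 ^ _) Ha Hb => x y; nia.
Qed.

Lemma bitsizeN a : bitsize (- a)%R = bitsize a.
Proof. by rewrite /bitsize abszN. Qed.

Lemma bitsize_mono (a b : int) : `|a|%N <= `|b|%N -> bitsize a <= bitsize b.
Proof. by move=> H; rewrite /bitsize !ltnS; apply: leq_trunc_log. Qed.

(* Encodings have size at least 2, so a single power also absorbs constants.  *)
Definition poly_bounded (q : nat -> nat) := exists K, forall n, 2 <= n -> q n <= n ^ K.

Lemma poly_bounded_le q r : (forall n, 2 <= n -> q n <= r n) -> poly_bounded r -> poly_bounded q.
Proof. by move=> H [K HK]; exists K => n n2; apply: leq_trans (HK n n2); apply: H. Qed.

Lemma poly_bounded_const c : poly_bounded (fun _ => c).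
Proof.
exists c => n n2; apply: leq_trans (ltnW (ltn_expl c (ltnSn 1))) _.
by case: c => // c; rewrite leq_exp2r.
Qed.

Lemma poly_bounded_id : poly_bounded (fun n => n).
Proof. by exists 1 => n _; rewrite expn1. Qed.

Lemma poly_bounded_mul q r : poly_bounded q -> poly_bounded r ->
  poly_bounded (fun n => q n * r n).
Proof. by move=> [K HK] [L HL]; exists (K + L) => n n2; rewrite expnD leq_mul ?HK ?HL. Qed.

Lemma poly_bounded_add q r : poly_bounded q -> poly_bounded r ->
  poly_bounded (fun n => q n + r n).
Proof.
move=> [K HK] [L HL]; exists (K + L).+1 => n n2; rewrite expnS.
have n0 : 0 < n by lia.
apply: (@leq_trans (2 * n ^ (K + L))); last by rewrite leq_mul2r n2 orbT.
rewrite mul2n -addnn leq_add //.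
  by apply: leq_trans (HK n n2) _; rewrite leq_pexp2l // leq_addr.
by apply: leq_trans (HL n n2) _; rewrite leq_pexp2l // leq_addl.
Qed.

Lemma poly_bounded_S q : poly_bounded q -> poly_bounded (fun n => (q n).+1).
Proof. by move=> H; apply: poly_bounded_le (poly_bounded_add (poly_bounded_const 1) H). Qed.

Lemma poly_bounded_exp q K : poly_bounded q -> poly_bounded (fun n => q n ^ K).
Proof.
move=> [L HL]; exists (L * K) => n n2; rewrite expnM.
by case: K => // K; rewrite leq_exp2r // HL.
Qed.

Ltac solve_bounded := repeat first
  [ assumption | exact: poly_bounded_id | exact: poly_bounded_const
  | apply: poly_bounded_S | apply: poly_bounded_add | apply: poly_bounded_mul |
    apply: poly_bounded_exp ].

(** * Runs of programs and basic closure properties *)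

Local Arguments upd : simpl never.

Lemma upd_eq s x d : upd s x d x = d.
Proof. by rewrite /upd eqxx. Qed.

Lemma upd_neq s x d y : y != x -> upd s x d y = s y.
Proof. by rewrite /upd => /negbTE ->. Qed.

Ltac updE := repeat first [ rewrite upd_eq | rewrite upd_neq; last by lia ].

Lemma dsize_eval s e : dsize (eval s e) <= cost s e.
Proof. by case: e => * /=; lia. Qed.

(** Evaluating an expression costs at least the size of its value, so a run cannot write anything
    larger than its running time. *)
Lemma exec_dsize c s t s' : exec c s t s' -> forall x, dsize (s' x) <= maxn (dsize (s x)) t.
Proof.
elim=> {c s t s'}.
- by move=> s x; rewrite leq_maxl.
- move=> s x e y; rewrite /upd; case: eqP => _; last by rewrite leq_maxl.
  by have := dsize_eval s e; lia.
- by move=> c1 c2 s1 s2 s3 t1 t2 _ IH1 _ IH2 x; move: (IH1 x) (IH2 x); lia.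
- by move=> e c1 c2 s s' t _ IH x; move: (IH x); lia.
- by move=> e c s _ x; rewrite leq_maxl.
- by move=> e c s1 s2 s3 t1 t2 _ _ IH1 _ IH2 x; move: (IH1 x) (IH2 x); lia.
Qed.

(* The run must be correct whatever the other variables hold, and keep those   *)
(* from [m] on: this makes programs composable, [m] on being free for saving.  *)
Definition computes (D : data -> Prop) (f : data -> data) c m K :=
  forall s, D (s 0) -> exists t s', [/\ exec c s t s', s' 0 = f (s 0),
    forall x, m <= x -> s' x = s x & t <= dsize (s 0) ^ K].

Definition polytime (D : data -> Prop) (f : data -> data) :=
  exists c m K, computes D f c m K.

Definition any_data (d : data) := True.

Lemma polytime_size D f : polytime D f -> exists K, forall d, D d -> dsize (f d) <= dsize d ^ K.
Proof.
move=> [c [m [K H]]]; exists K.+1 => d Dd.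
have [t [s' [E F _ T]]] := H (fun _ => d) Dd.
have := exec_dsize E 0; rewrite F => L; apply: leq_trans L _.
have d2 := dsize_ge2 d; rewrite geq_max -{1}(expn1 (dsize d)) leq_pexp2l //=; last by lia.
by apply: leq_trans T _; rewrite leq_pexp2l //; lia.
Qed.

Lemma polytime_ext D f g : (forall d, D d -> f d = g d) -> polytime D f -> polytime D g.
Proof.
move=> E [c [m [K H]]]; exists c, m, K => s Ds.
by have [t [s' [? ? ? ?]]] := H s Ds; exists t, s'; rewrite -E.
Qed.

Lemma polytime_comp D D' f g : polytime D' g -> polytime D f -> (forall d, D d -> D' (f d)) ->
  polytime D (fun d => g (f d)).
Proof.
move=> [cg [mg [Kg Hg]]] Ff DD'; have [Kf' Sf] := polytime_size Ff.
case: Ff => [cf [mf [Kf Hf]]].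
have [K HK] : poly_bounded (fun n => n ^ Kf + (n ^ Kf') ^ Kg + 1) by solve_bounded.
exists (CSeq cf cg), (maxn mf mg), K => s Ds.
have [t1 [s1 [E1 F1 R1 T1]]] := Hf s Ds.
have Ds1 : D' (s1 0) by rewrite F1; apply: DD'.
have [t2 [s2 [E2 F2 R2 T2]]] := Hg s1 Ds1.
exists (t1 + t2).+1, s2; split; first exact: exec_seq E1 E2.
- by rewrite F2 F1.
- by move=> x; rewrite geq_max => /andP[xf xg]; rewrite R2 ?R1.
apply: leq_trans (HK _ (dsize_ge2 _)); rewrite addn1 ltnS leq_add //.
apply: leq_trans T2 _; rewrite F1; case: (Kg) => // k.
by rewrite leq_exp2r //; apply: Sf.
Qed.

(** The second hypothesis makes [e] depend on variable 0 alone, so a single assignment computes it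
    whatever the other variables hold. *)
Lemma polytime_set D e (K : nat) : (forall s, D (s 0) -> cost s e <= dsize (s 0) ^ K) ->
  (forall s s', s 0 = s' 0 -> eval s e = eval s' e) ->
  polytime D (fun d => eval (fun _ => d) e).
Proof.
move=> HK E0; exists (CSet 0 e), 1, K.+1 => s Ds.
exists (cost s e).+1, (upd s 0 (eval s e)); split; first exact: exec_set.
- by rewrite upd_eq; apply: E0.
- by move=> x x0; rewrite upd_neq //; lia.
rewrite expnS; have := HK s Ds; have := dsize_ge2 (s 0).
have : 0 < dsize (s 0) ^ K by rewrite expn_gt0; have := dsize_ge2 (s 0); lia.
nia.
Qed.

Lemma dsize_dfst d : dsize (dfst d) <= dsize d.
Proof. by case: d => //= a b; lia. Qed.

Lemma dsize_dsnd d : dsize (dsnd d) <= dsize d.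
Proof. by case: d => //= a b; lia. Qed.

Lemma dsize_of_bool b : dsize (of_bool b) = 2.
Proof. by case: b. Qed.

Lemma bitsize_to_int d : bitsize (to_int d) <= dsize d.
Proof. by case: d => // a b; rewrite /= (_ : bitsize 0 = 2) //; have := dsize_ge2 a; lia. Qed.

Definition dadd a b := Atom (to_int a + to_int b)%R.
Definition dsub a b := Atom (to_int a - to_int b)%R.
Definition dmul a b := Atom (to_int a * to_int b)%R.
Definition dle a b := of_bool (to_int a <= to_int b)%R.

Lemma dsize_dadd a b : dsize (dadd a b) <= dsize a + dsize b.
Proof. by apply: leq_trans (bitsizeD _ _) _; apply: leq_add; apply: bitsize_to_int. Qed.

Lemma dsize_dsub a b : dsize (dsub a b) <= dsize a + dsize b.
Proof.
apply: leq_trans (bitsizeD _ _) _; rewrite bitsizeN.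
by apply: leq_add; apply: bitsize_to_int.
Qed.

Lemma dsize_dmul a b : dsize (dmul a b) <= dsize a + dsize b.
Proof. by apply: leq_trans (bitsizeM _ _) _; apply: leq_add; apply: bitsize_to_int. Qed.

Lemma polytime_id D : polytime D (fun d => d).
Proof.
by apply: (@polytime_set D (EVar 0) 1) => // s _; rewrite /= addn0 expn1.
Qed.

Lemma polytime_cst D z : polytime D (fun _ => Atom z).
Proof.
have [K HK] := poly_bounded_const (bitsize z).
by apply: (@polytime_set D (ECst z) K) => // s _; rewrite /= addn0 HK // dsize_ge2.
Qed.

Lemma polytime_set1 (e1 : expr -> expr) (f : data -> data) :
  (forall s e, eval s (e1 e) = f (eval s e)) ->
  (forall s e, cost s (e1 e) = dsize (f (eval s e)) + cost s e) ->
  (forall d, dsize (f d) <= dsize d) ->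
  forall D g, polytime D g -> polytime D (fun d => f (g d)).
Proof.
move=> Ev Ec Es D g Fg; apply: (@polytime_comp _ any_data) Fg _ => //.
apply: polytime_ext (@polytime_set _ (e1 (EVar 0)) 2 _ _); first by move=> d _; rewrite Ev.
  move=> s _; rewrite Ec /= addn0 -mulnn; have := Es (s 0); have := dsize_ge2 (s 0); nia.
by move=> s s' E; rewrite !Ev /= E.
Qed.

Definition isatom d := if d is Atom _ then true else false.

Lemma polytime_fst D f : polytime D f -> polytime D (fun d => dfst (f d)).
Proof. by apply: (@polytime_set1 EFst) => //; apply: dsize_dfst. Qed.

Lemma polytime_snd D f : polytime D f -> polytime D (fun d => dsnd (f d)).
Proof. by apply: (@polytime_set1 ESnd) => //; apply: dsize_dsnd. Qed.

Lemma polytime_isatom D f : polytime D f -> polytime D (fun d => of_bool (isatom (f d))).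
Proof. by apply: (@polytime_set1 EIsAtom (fun d => of_bool (isatom d))) => // d;
  rewrite dsize_of_bool dsize_ge2. Qed.

Lemma polytime_pair D f g : polytime D f -> polytime D g ->
  polytime D (fun d => Node (f d) (g d)).
Proof.
move=> Ff Fg; have [Kf' Sf] := polytime_size Ff; have [Kg' Sg] := polytime_size Fg.
case: Ff => [cf [mf [Kf Hf]]]; case: Fg => [cg [mg [Kg Hg]]].
have [K HK] : poly_bounded
  (fun n => n ^ Kf + n ^ Kg + 5 * (n + n ^ Kf' + n ^ Kg') + 20) by solve_bounded.
(* Neither program touches [M] or [M.+1], and the successor keeps [M] away from variable 0. [M]
   saves the input, [M.+1] the result of [cf]. *)
pose M := (maxn mf mg).+1.
exists (CSeq (CSet M (EVar 0)) (CSeq cf (CSeq (CSet M.+1 (EVar 0))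
  (CSeq (CSet 0 (EVar M)) (CSeq cg (CSet 0 (ENode (EVar M.+1) (EVar 0)))))))), M.+2, K.
move=> s Ds.
set s1 := upd s M (s 0).
have D1 : D (s1 0) by rewrite /s1 /M; updE.
have [t2 [s2 [E2 F2 R2 T2]]] := Hf s1 D1.
set s3 := upd s2 M.+1 (s2 0).
set s4 := upd s3 0 (s3 M).
have s40 : s4 0 = s 0 by rewrite /s4 /s3 /M; updE; rewrite R2 /s1 /M; [updE | lia].
have D4 : D (s4 0) by rewrite s40.
have [t5 [s5 [E5 F5 R5 T5]]] := Hg s4 D4.
have s5M : s5 M.+1 = f (s 0).
  by rewrite R5 /s4 /s3 /M; [updE; rewrite F2 /s1 /M; updE | lia].
eexists _, _; split.
- apply: exec_seq; first exact: exec_set.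
  apply: exec_seq; first exact: E2.
  apply: exec_seq; first exact: exec_set.
  apply: exec_seq; first exact: exec_set.
  apply: exec_seq; first exact: E5.
  exact: exec_set.
- by rewrite upd_eq /= s5M F5 s40.
- move=> x xM; rewrite upd_neq; last by rewrite /M in xM; lia.
  rewrite /M in xM; rewrite R5; last by lia.
  rewrite /s4 /s3 /s1 /M; updE; rewrite R2; last by lia.
  by rewrite /s1 /M; updE.
rewrite s40 in T5.
have s10 : s1 0 = s 0 by rewrite /s1 /M; updE.
rewrite s10 in T2; apply: leq_trans (HK _ (dsize_ge2 _)).
have s3M : s3 M = s 0 by rewrite /s3 /M; updE; rewrite R2 /s1 /M; [updE | lia].
rewrite /= -/s1 -/s3 -/s4 s5M F5 s40 F2 s10 s3M.
by have := Sf _ Ds; have := Sg _ Ds; lia.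
Qed.

Lemma polytime_set2 (e2 : expr -> expr -> expr) (f : data -> data -> data) :
  (forall s e e', eval s (e2 e e') = f (eval s e) (eval s e')) ->
  (forall s e e', cost s (e2 e e') = dsize (f (eval s e) (eval s e')) + (cost s e + cost s e')) ->
  (forall a b, dsize (f a b) <= dsize a + dsize b) ->
  forall D g h, polytime D g -> polytime D h -> polytime D (fun d => f (g d) (h d)).
Proof.
move=> Ev Ec Es D g h Fg Fh.
apply: (@polytime_comp _ any_data (fun d => Node (g d) (h d))
  (fun x => f (dfst x) (dsnd x))) => //;
  last exact: polytime_pair.
(* Two reads of the input, two projections, and a result no larger than the two projections
   together. *)
have [K HK] : poly_bounded (fun n => 6 * n) by solve_bounded.
apply: polytime_ext (@polytime_set _ (e2 (EFst (EVar 0)) (ESnd (EVar 0))) K _ _).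
- by move=> d _; rewrite Ev.
- move=> s _; rewrite Ec /=; apply: leq_trans (HK _ (dsize_ge2 _)).
  have := Es (dfst (s 0)) (dsnd (s 0)); have := dsize_dfst (s 0); have := dsize_dsnd (s 0); lia.
- by move=> s s' E; rewrite !Ev /= E.
Qed.

Lemma polytime_add D f g : polytime D f -> polytime D g -> polytime D (fun d => dadd (f d) (g d)).
Proof. by apply: (@polytime_set2 EAdd) => //; apply: dsize_dadd. Qed.

Lemma polytime_sub D f g : polytime D f -> polytime D g -> polytime D (fun d => dsub (f d) (g d)).
Proof. by apply: (@polytime_set2 ESub) => //; apply: dsize_dsub. Qed.

Lemma polytime_mul D f g : polytime D f -> polytime D g -> polytime D (fun d => dmul (f d) (g d)).
Proof. by apply: (@polytime_set2 EMul) => //; apply: dsize_dmul. Qed.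

Lemma polytime_le D f g : polytime D f -> polytime D g -> polytime D (fun d => dle (f d) (g d)).
Proof.
apply: (@polytime_set2 ELe) => // a b; rewrite dsize_of_bool.
by have := dsize_ge2 a; lia.
Qed.

Lemma polytime_if D b f g : polytime D b -> polytime D f -> polytime D g ->
  polytime D (fun d => if truth (b d) then f d else g d).
Proof.
move=> Fb Ff Fg.
have [Kb' Sb] := polytime_size Fb.
case: Fb => [cb [mb [Kb Hb]]]; case: Ff => [cf [mf [Kf Hf]]]; case: Fg => [cg [mg [Kg Hg]]].
have [K HK] : poly_bounded
  (fun n => n ^ Kb + n ^ Kf + n ^ Kg + 5 * (n + n ^ Kb') + 20) by solve_bounded.
pose M := (maxn mb (maxn mf mg)).+1.
exists (CSeq (CSet M (EVar 0)) (CSeq cb (CSeq (CSet M.+1 (EVar 0))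
  (CSeq (CSet 0 (EVar M)) (CIf (EVar M.+1) cf cg))))), M.+2, K.
move=> s Ds.
set s1 := upd s M (s 0).
have s10 : s1 0 = s 0 by rewrite /s1 /M; updE.
have D1 : D (s1 0) by rewrite s10.
have [t2 [s2 [E2 F2 R2 T2]]] := Hb s1 D1.
set s3 := upd s2 M.+1 (s2 0).
have s3M : s3 M = s 0 by rewrite /s3 /M; updE; rewrite R2 /s1 /M; [updE | lia].
set s4 := upd s3 0 (s3 M).
have s40 : s4 0 = s 0 by rewrite /s4; updE.
have D4 : D (s4 0) by rewrite s40.
have s4M : s4 M.+1 = b (s 0) by rewrite /s4 /s3; updE; rewrite F2 s10.
have [t5 [s5 [E5 F5 R5 T5]]] : exists t5 s5,
  [/\ exec (if truth (b (s 0)) then cf else cg) s4 t5 s5,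
      s5 0 = if truth (b (s 0)) then f (s 0) else g (s 0),
      forall x, maxn mf mg <= x -> s5 x = s4 x &
      t5 <= dsize (s 0) ^ Kf + dsize (s 0) ^ Kg].
  case: (truth _).
  - have [t5 [s5 [E5 F5 R5 T5]]] := Hf s4 D4.
    exists t5, s5; split => //; rewrite -?s40 //; last by lia.
    by move=> x xm; apply: R5; lia.
  - have [t5 [s5 [E5 F5 R5 T5]]] := Hg s4 D4.
    exists t5, s5; split => //; rewrite -?s40 //; last by lia.
    by move=> x xm; apply: R5; lia.
eexists _, _; split.
- apply: exec_seq; first exact: exec_set.
  apply: exec_seq; first exact: E2.
  apply: exec_seq; first exact: exec_set.
  apply: exec_seq; first exact: exec_set.
  by apply: exec_if; rewrite /= -/s1 -/s3 -/s4 s4M; apply: E5.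
- by rewrite F5.
- move=> x xM; rewrite /M in xM; rewrite R5; last by lia.
  rewrite /s4 /s3 /s1 /M; updE; rewrite R2; last by lia.
  by rewrite /s1 /M; updE.
rewrite s10 in T2; apply: leq_trans (HK _ (dsize_ge2 _)).
rewrite /= -/s1 -/s3 -/s4 s4M F2 s10 s3M.
by have := Sb _ Ds; lia.
Qed.

(** * Folds over lists, any tree being read as a list along its right spine *)

Fixpoint dlist d := if d is Node a b then a :: dlist b else [::].

Lemma enc_seqK l : dlist (enc_seq l) = l.
Proof. by elim: l => //= a l ->. Qed.

Section FoldLoop.
Variables (h : data -> data -> data -> data) (c : cmd) (m K : nat).
Hypothesis hc : computes any_data (fun x => h (dfst x) (dfst (dsnd x)) (dsnd (dsnd x))) c m K.

(* Variables [m.+1], [m.+2] and [m.+3], which [c] leaves alone, hold the       *)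
(* parameter, the accumulator and the rest of the list.                        *)
Definition fold_loop :=
  CWhile (ESub (ECst 1) (EIsAtom (EVar m.+3)))
    (CSeq (CSet 0 (ENode (EVar m.+1) (ENode (EVar m.+2) (EFst (EVar m.+3)))))
    (CSeq c (CSeq (CSet m.+2 (EVar 0)) (CSet m.+3 (ESnd (EVar m.+3)))))).

(** Subtracting from 1 negates the test. The result, the constant and the value of the test have
    size 2 each. *)
Lemma cost_nonatom s x :
  cost s (ESub (ECst 1) (EIsAtom (EVar x))) = 6 + dsize (s x).
Proof.
by rewrite /=; case: (s x) => [z|a b] /=; rewrite !addn0.
Qed.

(** A common bound [S] on the parameter, the list and all partial accumulators makes every round
    equally cheap. The body receives three such values under two nodes, whence [4 * S]. *)
Lemma fold_loopP S p l s acc :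
  s m.+1 = p -> s m.+2 = acc -> s m.+3 = l -> 2 <= S ->
  dsize p <= S -> dsize l <= S ->
  (forall j, dsize (foldl (h p) acc (take j (dlist l))) <= S) ->
  exists t s', [/\ exec fold_loop s t s', s' m.+2 = foldl (h p) acc (dlist l),
    forall x, m.+4 <= x -> s' x = s x &
    t <= (size (dlist l)).+1 * ((4 * S) ^ K + 30 * S + 30)].
Proof.
move=> sp sa sl S2 pS lS H.
elim: l acc s sp sa sl lS H => [z | a _ b IH] acc s sp sa sl lS H.
  exists (cost s (ESub (ECst 1) (EIsAtom (EVar m.+3)))).+1, s; split => //.
    by apply: exec_while_stop; rewrite /= sl.
  by rewrite cost_nonatom sl mul1n; lia.
have accS : dsize acc <= S by have := H 0; rewrite take0.
set s1 := upd s 0 (Node p (Node acc a)).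
have s10 : s1 0 = Node p (Node acc a) by rewrite /s1; updE.
have [t2 [s2 [E2 F2 R2 T2]]] := hc (s := s1) I.
have F2' : s2 0 = h p acc a by rewrite F2 s10.
set s3 := upd s2 m.+2 (s2 0).
set s4 := upd s3 m.+3 (dsnd (s3 m.+3)).
have s3l : s3 m.+3 = Node a b.
  by rewrite /s3; updE; rewrite R2; last lia; rewrite /s1; updE.
have s4p : s4 m.+1 = p by rewrite /s4 /s3; updE; rewrite R2; last lia; rewrite /s1; updE.
have s4a : s4 m.+2 = h p acc a by rewrite /s4 /s3; updE.
have s4l : s4 m.+3 = b by rewrite /s4; updE; rewrite s3l.
have bS : dsize b <= S by move: lS => /=; lia.
have aS : dsize a <= S by move: lS => /=; lia.
have [j | t5 [s5 [E5 F5 R5 T5]]] := IH (h p acc a) s4 s4p s4a s4l bS.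
  exact: H j.+1.
eexists _, s5; split.
- apply: exec_while_step; first by rewrite /= sl.
    apply: exec_seq; first exact: exec_set.
    rewrite /= sp sa sl.
    apply: exec_seq; first exact: E2.
    apply: exec_seq; first exact: exec_set.
    apply: exec_set.
  exact: E5.
- by rewrite F5.
- move=> x xm; rewrite R5 // /s4 /s3; updE; rewrite R2; last by lia.
  by rewrite /s1; updE.
rewrite [size _]/= mulSn.
have hS : dsize (h p acc a) <= S by have := H 1; rewrite /= take0.
have {}T2 : t2 <= (4 * S) ^ K.
  apply: leq_trans T2 _; case: (K) => // k; rewrite leq_exp2r // s10 /=; lia.
rewrite cost_nonatom sl; move: T5; rewrite /= -/s1 -/s3 sp sa sl s3l /= F2'.
set A := (_.+1 * _); set B := (_ ^ _) in T2 *.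
by move: lS => /= *; lia.
Qed.

End FoldLoop.

Lemma size_dlist d : size (dlist d) <= dsize d.
Proof. by elim: d => //= a _ b; have := dsize_ge2 a; lia. Qed.

(** A fold of polynomial-time steps can blow up, as repeated squaring shows. The last hypothesis
    excludes this by bounding every partial accumulator. *)
Lemma polytime_fold D p i l h :
  polytime any_data (fun x => h (dfst x) (dfst (dsnd x)) (dsnd (dsnd x))) ->
  polytime D p -> polytime D i -> polytime D l ->
  (exists K, forall d, D d -> forall j,
     dsize (foldl (h (p d)) (i d) (take j (dlist (l d)))) <= dsize d ^ K) ->
  polytime D (fun d => foldl (h (p d)) (i d) (dlist (l d))).
Proof.
move=> [c [m [K hc]]] Fp Fi Fl [K1 H1].
have [Kp Sp] := polytime_size Fp; have [Kl Sl] := polytime_size Fl; have [Ki Si] :=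
  polytime_size Fi.
have : polytime D (fun d => Node (p d) (Node (i d) (l d))) by do 2!apply: polytime_pair => //.
case=> [c0 [m0 [K0 H0]]].
pose M := maxn m m0.
have hcM : computes any_data (fun x => h (dfst x) (dfst (dsnd x)) (dsnd (dsnd x))) c M K.
  move=> s Ds; have [t [s' [E F R T]]] := hc s Ds; exists t, s'; split=> // x xM.
  by apply: R; lia.
pose S n := n + n ^ K1 + n ^ Kp + n ^ Ki + n ^ Kl.
have [Kf HK] : poly_bounded
  (fun n => n ^ K0 + (S n).+1 * ((4 * S n) ^ K + 30 * S n + 30) + 30 * S n + 30).
  by rewrite /S; solve_bounded.
exists (CSeq c0 (CSeq (CSet M.+1 (EFst (EVar 0))) (CSeq (CSet M.+2 (EFst (ESnd (EVar 0))))
  (CSeq (CSet M.+3 (ESnd (ESnd (EVar 0)))) (CSeq (fold_loop c M) (CSet 0 (EVar M.+2))))))),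
    M.+4, Kf.
move=> s Ds; set d := s 0.
have [t1 [s1 [E1 F1 R1 T1]]] := H0 s Ds; rewrite -/d in F1 T1 Ds.
set s2 := upd s1 M.+1 (p d).
set s3 := upd s2 M.+2 (i d).
set s4 := upd s3 M.+3 (l d).
have s20 : s2 0 = Node (p d) (Node (i d) (l d)) by rewrite /s2; updE.
have s30 : s3 0 = Node (p d) (Node (i d) (l d)) by rewrite /s3; updE.
have d2 := dsize_ge2 d.
have [||||||j|t5 [s5 [E5 F5 R5 T5]]] :=
  @fold_loopP h c M K hcM (S (dsize d)) (p d) (l d) s4 (i d).
- by rewrite /s4 /s3 /s2; updE.
- by rewrite /s4 /s3; updE.
- by rewrite /s4; updE.
- by rewrite /S; lia.
- by apply: leq_trans (Sp d Ds) _; rewrite /S; lia.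
- by apply: leq_trans (Sl d Ds) _; rewrite /S; lia.
- by apply: leq_trans (H1 d Ds j) _; rewrite /S; lia.
have dl : size (dlist (l d)) <= S (dsize d).
  by apply: leq_trans (size_dlist _) _; apply: leq_trans (Sl d Ds) _; rewrite /S; lia.
eexists _, _; split.
- apply: exec_seq; first exact: E1.
  apply: exec_seq; first exact: exec_set.
  rewrite /= F1 /=.
  apply: exec_seq; first exact: exec_set.
  rewrite /= -/s2 s20 /=.
  apply: exec_seq; first exact: exec_set.
  rewrite /= -/s3 s30 /=.
  apply: exec_seq; first exact: E5.
  exact: exec_set.
- by rewrite upd_eq /= F5.
- move=> x xM; rewrite upd_neq; last by lia.
  rewrite R5 // /s4 /s3 /s2; updE; rewrite R1 //; lia.
apply: leq_trans (HK _ d2).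
have fS : dsize (foldl (h (p d)) (i d) (dlist (l d))) <= S (dsize d).
  have := H1 d Ds (size (dlist (l d))); rewrite take_size => H.
  by apply: leq_trans H _; rewrite /S; lia.
have pS : dsize (p d) <= S (dsize d).
  by apply: leq_trans (Sp d Ds) _; rewrite /S; lia.
have iS : dsize (i d) <= S (dsize d).
  by apply: leq_trans (Si d Ds) _; rewrite /S; lia.
have lS : dsize (l d) <= S (dsize d).
  by apply: leq_trans (Sl d Ds) _; rewrite /S; lia.
rewrite /= -/s2 -/s3 s20 s30 F1 /= F5.
have {}T5 : t5 <= (S (dsize d)).+1 * ((4 * S (dsize d)) ^ K + 30 * S (dsize d) + 30).
  by apply: leq_trans T5 _; rewrite leq_mul2r ltnS dl orbT.
move: T5; set X := (_.+1 * _); move: (S (dsize d)) X pS iS lS fS => SS X; lia.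
Qed.

Notation polytime_pred D b := (polytime D (fun d => of_bool (b d))).

Lemma truth_of_bool b : truth (of_bool b) = b.
Proof. by case: b. Qed.

Lemma polytime_app2 D F a b : polytime any_data (fun x => F (dfst x) (dsnd x)) ->
  polytime D a -> polytime D b -> polytime D (fun d => F (a d) (b d)).
Proof.
move=> FF Fa Fb.
exact: (@polytime_comp D any_data (fun d => Node (a d) (b d)) _ FF (polytime_pair Fa Fb)).
Qed.

Lemma polytime_app3 D F a b c :
  polytime any_data (fun x => F (dfst x) (dfst (dsnd x)) (dsnd (dsnd x))) ->
  polytime D a -> polytime D b -> polytime D c -> polytime D (fun d => F (a d) (b d) (c d)).
Proof.
move=> FF Fa Fb Fc.
exact: (@polytime_app2 D (fun p q => F p (dfst q) (dsnd q)) _ _ FF Fa (polytime_pair Fb Fc)).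
Qed.

Lemma polytime_app4 D F a b c e :
  polytime any_data (fun x =>
    F (dfst x) (dfst (dsnd x)) (dfst (dsnd (dsnd x))) (dsnd (dsnd (dsnd x)))) ->
  polytime D a -> polytime D b -> polytime D c -> polytime D e ->
    polytime D (fun d => F (a d) (b d) (c d) (e d)).
Proof.
move=> FF Fa Fb Fc Fe.
exact: (@polytime_app3 D (fun p q r => F p q (dfst r) (dsnd r)) _ _ _ FF Fa Fb
  (polytime_pair Fc Fe)).
Qed.

Lemma polytime_app5 D F a b c e f :
  polytime any_data (fun x => F (dfst x) (dfst (dsnd x)) (dfst (dsnd (dsnd x)))
    (dfst (dsnd (dsnd (dsnd x)))) (dsnd (dsnd (dsnd (dsnd x))))) ->
  polytime D a -> polytime D b -> polytime D c -> polytime D e -> polytime D f ->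
  polytime D (fun d => F (a d) (b d) (c d) (e d) (f d)).
Proof.
move=> FF Fa Fb Fc Fe Ff.
exact: (@polytime_app4 D (fun p q r s => F p q r (dfst s) (dsnd s)) _ _ _ _ FF Fa Fb Fc
  (polytime_pair Fe Ff)).
Qed.

Lemma polytime_if_pred D b f g : polytime_pred D b -> polytime D f -> polytime D g ->
  polytime D (fun d => if b d then f d else g d).
Proof.
move=> Fb Ff Fg; apply: polytime_ext (polytime_if Fb Ff Fg) => d _.
by rewrite truth_of_bool.
Qed.

Lemma polytime_pred_truth D f : polytime D f -> polytime_pred D (fun d => truth (f d)).
Proof.
move=> Ff; apply: polytime_ext (polytime_if Ff (polytime_cst D 1) (polytime_cst D 0)) => d _.
by case: (truth _).
Qed.

Lemma polytime_pred_neg D b : polytime_pred D b -> polytime_pred D (fun d => ~~ b d).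
Proof.
move=> Fb; apply: polytime_ext (polytime_if_pred Fb (polytime_cst D 0) (polytime_cst D 1)) => d _.
by case: (b d).
Qed.

Lemma polytime_pred_and D a b : polytime_pred D a -> polytime_pred D b ->
  polytime_pred D (fun d => a d && b d).
Proof.
move=> Fa Fb; apply: polytime_ext (polytime_if_pred Fa Fb (polytime_cst D 0)) => d _.
by case: (a d).
Qed.

Lemma polytime_pred_imp D a b : polytime_pred D a -> polytime_pred D b ->
  polytime_pred D (fun d => a d ==> b d).
Proof.
move=> Fa Fb; apply: polytime_ext (polytime_if_pred Fa Fb (polytime_cst D 1)) => d _.
by case: (a d).
Qed.

Lemma polytime_pred_le D f g : polytime D f -> polytime D g ->
  polytime_pred D (fun d => (to_int (f d) <= to_int (g d))%R).
Proof. exact: polytime_le. Qed.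

Lemma polytime_pred_eq D f g : polytime D f -> polytime D g ->
  polytime_pred D (fun d => to_int (f d) == to_int (g d)).
Proof.
move=> Ff Fg; apply: polytime_ext
  (polytime_pred_and (polytime_pred_le Ff Fg) (polytime_pred_le Fg Ff)) => d _.
by rewrite -eq_le.
Qed.

(** Growth by a fixed amount per round stays polynomial in total. *)
Lemma foldl_growth (h : data -> data -> data) B l acc j :
  (forall acc a, dsize a <= dsize l -> dsize (h acc a) <= dsize acc + B) ->
  dsize (foldl h acc (take j (dlist l))) <= dsize acc + dsize l * B.
Proof.
(* The size bound on the items is detached from the list, so that it survives the passage to
   tails. *)
move=> H; suff Hs : forall S l',
  (forall acc a, dsize a <= S -> dsize (h acc a) <= dsize acc + B) ->
    dsize l' <= S -> forall acc j, dsize (foldl h acc (take j (dlist l'))) <=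
      dsize acc + dsize l' * B.
  exact: (Hs (dsize l)).
move=> S {H l acc j}; elim=> [z|a _ b IH] H lS acc [|j] /=; try by lia.
rewrite /= in lS; apply: leq_trans (IH H _ _ _) _; first by lia.
have : dsize (h acc a) <= dsize acc + B by apply: H; lia.
have := dsize_ge2 a; nia.
Qed.

(** The criterion for most loops: the growth allowed in a round depends on the input and the item,
    not on the accumulator. *)
Lemma polytime_foldl D l i h :
  polytime any_data (fun x => h (dfst x) (dfst (dsnd x)) (dsnd (dsnd x))) -> polytime D i ->
    polytime D l ->
  (exists K, forall d acc a, dsize (h d acc a) <= dsize acc + dsize (Node d a) ^ K) ->
  polytime D (fun d => foldl (h d) (i d) (dlist (l d))).
Proof.
move=> Fh Fi Fl [K H].
apply: (polytime_fold Fh (polytime_id D) Fi Fl).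
have [Ki Hi] := polytime_size Fi; have [Kl Hl] := polytime_size Fl.
have [K' HK] : poly_bounded (fun n => n ^ Ki + n ^ Kl * (n + n ^ Kl + 1) ^ K) by solve_bounded.
exists K' => d Dd j; apply: leq_trans (HK _ (dsize_ge2 d)).
apply: leq_trans (@foldl_growth (h d) ((dsize d + dsize d ^ Kl + 1) ^ K) _ _ _ _) _.
  move=> acc a al; apply: leq_trans (H _ _ _) _; rewrite leq_add2l /=.
  by case: (K) => // k; rewrite leq_exp2r //; have := Hl d Dd; lia.
by rewrite leq_add ?leq_mul ?Hi ?Hl.
Qed.

Lemma foldl_cons l z : foldl (fun acc a => Node a acc) z l = foldr Node z (rev l).
Proof. by rewrite -{1}(revK l) foldl_rev. Qed.

Lemma dsize_enc_seq B l : (forall i, i < size l -> dsize (nth (Atom 0) l i) <= B) ->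
  dsize (enc_seq l) <= size l * B.+1 + 2.
Proof.
elim: l => //= a l IH H.
have := H 0 isT; have /= := IH (fun i => H i.+1); lia.
Qed.

Lemma polytime_rev D l : polytime D l -> polytime D (fun d => enc_seq (rev (dlist (l d)))).
Proof.
move=> Fl; have F : polytime D (fun d => foldl (fun acc a => Node a acc) (Atom 0) (dlist (l d))).
  apply: (@polytime_foldl D l (fun _ => Atom 0) (fun d acc a => Node a acc)) => //.
  - by apply: polytime_pair;
    [do 2!apply: polytime_snd; apply: polytime_id | apply: polytime_fst; apply: polytime_snd;
    apply: polytime_id].
  - exact: polytime_cst.
  by exists 1 => d acc a; rewrite /= expn1; lia.
by apply: polytime_ext F => d _; rewrite foldl_cons.
Qed.

(** Consing during a fold yields the images in reverse order; [polytime_rev] restores it. *)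
Lemma polytime_map D l h : polytime any_data (fun x => h (dfst x) (dsnd x)) -> polytime D l ->
  polytime D (fun d => enc_seq (map (h d) (dlist (l d)))).
Proof.
move=> Fh Fl; have [K Hh] := polytime_size Fh.
have F : polytime D (fun d => foldl (fun acc a => Node (h d a) acc) (Atom 0) (dlist (l d))).
  apply: (@polytime_foldl D l (fun _ => Atom 0) (fun d acc a => Node (h d a) acc)) => //.
  - apply: polytime_pair; last by apply: polytime_fst; apply: polytime_snd; apply: polytime_id.
    by apply: (@polytime_app2 _ h) => //;
      [apply: polytime_fst; apply: polytime_id | do 2!apply: polytime_snd; apply: polytime_id].
  - exact: polytime_cst.
  have [K' HK] : poly_bounded (fun n => n ^ K + 1) by solve_bounded.
  exists K' => d acc a; have := HK _ (dsize_ge2 (Node d a)).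
  by have := Hh (Node d a) I; rewrite /=; lia.
apply: polytime_ext (polytime_rev F) => d _.
have -> : foldl (fun acc a => Node (h d a) acc) (Atom 0) (dlist (l d))
  = enc_seq (rev (map (h d) (dlist (l d)))).
  rewrite -/(enc_seq _) /enc_seq -map_rev -{1}(revK (dlist (l d))) foldl_rev.
  by rewrite foldr_map.
by rewrite enc_seqK revK.
Qed.

Lemma polytime_filter D l P : polytime_pred any_data (fun x => P (dfst x) (dsnd x)) ->
  polytime D l ->
  polytime D (fun d => enc_seq (filter (P d) (dlist (l d)))).
Proof.
move=> Fh Fl.
have F : polytime D (fun d =>
  foldl (fun acc a => if P d a then Node a acc else acc) (Atom 0) (dlist (l d))).
  apply: (@polytime_foldl D l (fun _ => Atom 0)
    (fun d acc a => if P d a then Node a acc else acc)) => //.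
  - have Facc : polytime any_data (fun x => dfst (dsnd x)) by apply: polytime_fst;
    apply: polytime_snd; apply: polytime_id.
    have Fa : polytime any_data (fun x => dsnd (dsnd x)) by do 2!apply: polytime_snd;
      apply: polytime_id.
    apply: polytime_if_pred => //; last exact: polytime_pair.
    by apply: (@polytime_app2 _ (fun a b => of_bool (P a b))) => //; apply: polytime_fst;
      apply: polytime_id.
  - exact: polytime_cst.
  by exists 1 => d acc a; rewrite /= expn1; case: ifP => _ /=; lia.
apply: polytime_ext (polytime_rev F) => d _.
have -> : foldl (fun acc a => if P d a then Node a acc else acc) (Atom 0) (dlist (l d))
  = enc_seq (rev (filter (P d) (dlist (l d)))).
  rewrite -filter_rev -{1}(revK (dlist (l d))) foldl_rev.
  by elim: (rev _) => //= a s ->; case: ifP.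
by rewrite enc_seqK revK.
Qed.

Lemma polytime_pred_all D l P : polytime_pred any_data (fun x => P (dfst x) (dsnd x)) ->
  polytime D l ->
  polytime_pred D (fun d => all (P d) (dlist (l d))).
Proof.
move=> Fh Fl.
have Fn : polytime_pred any_data (fun x => ~~ P (dfst x) (dsnd x)) by apply: polytime_pred_neg.
have F := polytime_isatom (@polytime_filter D l (fun d a => ~~ P d a) Fn Fl).
apply: polytime_ext F => d _; congr of_bool.
by elim: (dlist _) => //= a s; case: (P d a).
Qed.

Lemma polytime_pred_has D l P : polytime_pred any_data (fun x => P (dfst x) (dsnd x)) ->
  polytime D l ->
  polytime_pred D (fun d => has (P d) (dlist (l d))).
Proof.
move=> Fh Fl; apply: polytime_ext
  (polytime_pred_neg (@polytime_pred_all D l (fun d a => ~~ P d a) (polytime_pred_neg Fh)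
  Fl)) => d _.
by rewrite all_predC negbK.
Qed.

(** Extension point, redefined once the operations on graphs have closure lemmas of their own. *)
Ltac polytime_hook := fail.

Ltac polytime_step :=
  lazymatch goal with
  | |- polytime _ (fun d => d) => exact: polytime_id
  | |- polytime _ dfst => exact: polytime_fst (polytime_id _)
  | |- polytime _ dsnd => exact: polytime_snd (polytime_id _)
  | |- polytime _ (fun d => Atom _) => exact: polytime_cst
  | |- polytime _ (fun d => Node _ _) => apply: polytime_pair
  | |- polytime _ (fun d => dfst _) => apply: polytime_fst
  | |- polytime _ (fun d => dsnd _) => apply: polytime_snd
  | |- polytime _ (fun d => dadd _ _) => apply: polytime_add
  | |- polytime _ (fun d => dsub _ _) => apply: polytime_sub
  | |- polytime _ (fun d => dmul _ _) => apply: polytime_mul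
  | |- polytime _ (fun d => of_bool (isatom _)) => apply: polytime_isatom
  | |- polytime _ (fun d => of_bool (truth _)) => apply: polytime_pred_truth
  | |- polytime _ (fun d => of_bool (~~ _)) => apply: polytime_pred_neg
  | |- polytime _ (fun d => of_bool (_ && _)) => apply: polytime_pred_and
  | |- polytime _ (fun d => of_bool (_ ==> _)) => apply: polytime_pred_imp
  | |- polytime _ (fun d => of_bool (all _ _)) => apply: polytime_pred_all
  | |- polytime _ (fun d => of_bool (has _ _)) => apply: polytime_pred_has
  | |- polytime _ (fun d => of_bool (_ <= _)%R) => apply: polytime_pred_le
  | |- polytime _ (fun d => of_bool (_ == _)) => apply: polytime_pred_eq
  | |- polytime _ (fun d => if _ then _ else _) => apply: polytime_if_pred
  | |- polytime _ (fun d => enc_seq (map _ _)) => apply: polytime_map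
  | |- polytime _ (fun d => enc_seq (filter _ _)) => apply: polytime_filter
  | |- polytime _ (fun d => foldl _ _ _) => apply: polytime_foldl
  | |- _ => polytime_hook
  end.
Ltac solve_polytime := repeat first [assumption | polytime_step].

(* The counter becomes -1 once the item has been found.                        *)
Definition dnth l i := dsnd (foldl (fun acc a =>
  if to_int (dfst acc) == to_int (Atom 0) then Node (Atom (-1)) a
  else Node (dsub (dfst acc) (Atom 1)) (dsnd acc)) (Node i (Atom 0)) (dlist l)).

Lemma polytime_dnth D l i : polytime D l -> polytime D i ->
  polytime D (fun d => dnth (l d) (i d)).
Proof.
apply: polytime_app2; rewrite /dnth; solve_polytime; exists 2 => d acc a.
have acc2 := dsize_ge2 acc; have d2 := dsize_ge2 d; have a2 := dsize_ge2 a.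
have N25 : dsize (Node d a) + 20 <= dsize (Node d a) ^ 2 by rewrite -mulnn /=; nia.
case: ifP => _; first by move: N25; rewrite /= (_ : bitsize _ = 2) //; lia.
apply: leq_trans (leq_add (leqnn _) N25).
have : bitsize (to_int (dfst acc) - 1)%R <= bitsize (to_int (dfst acc)) + 2.
  by apply: leq_trans (bitsizeD _ _) _.
have := bitsize_to_int (dfst acc).
have b0 : bitsize 0 = 2 by [].
case: acc acc2 => [z|x y]; rewrite /= ?b0.
  by move: (bitsize (0 - 1)) (bitsize z); clear; lia.
by move: (bitsize (to_int x - 1)) (bitsize _); lia.
Qed.

Lemma dnthE l i : i < size l -> dnth (enc_seq l) (Atom i%:Z) = nth (Atom 0) l i.
Proof.
rewrite /dnth enc_seqK /=; set h := fun acc a => _.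
(* A negative counter only decreases and never meets 0 again, so the item found is kept. *)
have negE : forall s z r, (z < 0)%R -> dsnd (foldl h (Node (Atom z) r) s) = r.
  elim=> //= a s IH z r z0; rewrite /h /= ifF; last by apply/negbTE; rewrite lt_eqF.
  by apply: IH => /=; lia.
move: (Atom 0) => x0; elim: l i x0 => // a l IH [|i] x0 /= il.
  by rewrite {2}/h /= negE.
rewrite {2}/h /=.
have -> : dsub (Atom i.+1) (Atom 1) = Atom i by congr Atom => /=; lia.
by rewrite IH //; apply: set_nth_default.
Qed.

(** * The algorithm on encodings *)

(* A vertex is encoded by its index; [vs] lists all vertices, [W] their current *)
(* integer weights and [A] the rows of the adjacency matrix. The state [S] of   *)
(* the main loop pairs the weights with the stack of centres already used.      *)
Definition dlen l := foldl (fun acc _ => dadd acc (Atom 1)) (Atom 0) (dlist l).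

(** The length of the accumulator is the next index, so no separate counter is carried. *)
Definition diota l :=
  enc_seq (rev (dlist (foldl (fun acc _ => Node (dlen acc) acc) (Atom 0) (dlist l)))).

Definition dmem u K := has (fun x => to_int x == to_int u) (dlist K).

Definition dadj A u v := truth (dnth (dnth A u) v).

Definition dpos W u := (to_int (Atom 1) <= to_int (dnth W u))%R.

(** Of the product of all denominators, that of [u] cancels against its own weight, hence its
    omission. *)
Definition dscaled ws vs u := dmul (dfst (dnth ws u))
  (foldl (fun acc x => if to_int x == to_int u then acc else dmul acc (dsnd (dnth ws x)))
     (Atom 1) (dlist vs)).

Definition dnbrs A vs W v := enc_seq (filter (fun u => dadj A v u && dpos W u) (dlist vs)).

Definition dcands A vs W :=
  enc_seq (filter (fun v => dpos W v && ~~ isatom (dnbrs A vs W v)) (dlist vs)).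

Definition dclique A R := foldl (fun K u =>
  if all (fun x => dadj A u x) (dlist K) then Node u K else K) (Atom 0) (dlist R).

Definition drest A R := enc_seq (filter (fun u => ~~ dmem u (dclique A R)) (dlist R)).

(** [N] doubles as the clock of the fold: every clique takes away at least one vertex, so [size N]
    rounds exhaust it. *)
Definition dcount A N := dsnd (foldl (fun acc _ => if isatom (dfst acc) then acc
  else Node (drest A (dfst acc)) (dadd (dsnd acc) (Atom 1))) (Node N (Atom 0)) (dlist N)).

Definition dratio W v N k := foldl (fun acc u =>
  if (to_int acc <= to_int (dmul k (dnth W u)))%R then acc else dmul k (dnth W u))
  (dnth W v) (dlist N).

Definition dreduce W v N k r := fun u => dsub (dmul k (dnth W u))
  (if to_int u == to_int v then dmul k r else if dmem u N then r else Atom 0).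

Definition dupdate vs W v N k :=
  enc_seq (map (dreduce W v N k (dratio W v N k)) (dlist vs)).

Definition dstep_at A vs W v :=
  dupdate vs W v (dnbrs A vs W v) (dcount A (dnbrs A vs W v)).

Definition dstep A vs S :=
  if isatom (dcands A vs (dfst S)) then S
  else Node (dstep_at A vs (dfst S) (dfst (dcands A vs (dfst S))))
            (Node (dfst (dcands A vs (dfst S))) (dsnd S)).

(** The current cover is kept implicitly, as the null vertices outside [Rm], so dropping a centre is
    a cons. *)
Definition dprune A vs W Rm v :=
  if all (fun u => dadj A v u ==> (~~ dpos W u && ~~ dmem u Rm)) (dlist vs)
  then Node v Rm else Rm.

Definition dloop A vs W := foldl (fun S _ => dstep A vs S) (Node W (Atom 0)) (dlist vs).

Definition doutput A vs S := enc_seq (map (fun u =>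
  of_bool (~~ dpos (dfst S) u &&
    ~~ dmem u (foldl (dprune A vs (dfst S)) (Atom 0) (dlist (dsnd S))))) (dlist vs)).

Definition dstart d := enc_seq (map (dscaled (dfst d) (diota (dfst d))) (dlist (diota (dfst d)))).

Definition dwvc d := doutput (dsnd d) (diota (dfst d))
  (dloop (dsnd d) (diota (dfst d)) (dstart d)).

(** * Index lists, and running time of the components *)

Lemma dlenE l : dlen l = Atom (size (dlist l))%:Z.
Proof.
rewrite /dlen -[Posz _]add0r; move: (0 : int)%R; elim: (dlist l) => [|a s IH] z /=.
  by rewrite addr0.
by rewrite /dadd /= IH; congr Atom; lia.
Qed.

Lemma foldl_lenE (s : seq data) : foldl (fun acc _ => Node (dlen acc) acc) (Atom 0) s
  = enc_seq (rev (map (fun i => Atom i%:Z) (iota 0 (size s)))).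
Proof.
elim/last_ind: s => // s a IH.
rewrite -cats1 foldl_cat IH /= dlenE enc_seqK size_rev size_map size_iota.
by rewrite size_cat addn1 -addn1 iotaD map_cat rev_cat.
Qed.

Lemma diotaE l : diota l = enc_seq (map (fun i => Atom i%:Z) (iota 0 (size (dlist l)))).
Proof. by rewrite /diota foldl_lenE enc_seqK revK. Qed.

Lemma polytime_app1 D F a : polytime any_data F -> polytime D a -> polytime D (fun d => F (a d)).
Proof. by move=> FF Fa; apply: (polytime_comp FF Fa). Qed.

Lemma polytime_dlen D l : polytime D l -> polytime D (fun d => dlen (l d)).
Proof.
apply: polytime_app1; rewrite /dlen; solve_polytime; exists 1 => d acc a; rewrite expn1.
apply: leq_trans (dsize_dadd _ _) _; rewrite leq_add2l.
by have := dsize_ge2 d; rewrite [dsize (Atom 1)]/= (_ : bitsize 1 = 2) //=; lia.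
Qed.

(** A round adds the length of the accumulator, so [polytime_foldl] does not apply; the closed form
    [foldl_lenE] bounds the partial results instead. *)
Lemma polytime_diota D l : polytime D l -> polytime D (fun d => diota (l d)).
Proof.
move=> Fl; apply: polytime_rev.
have [K HK] : poly_bounded (fun n => n * (n + 3) + 2) by solve_bounded.
have [K' HK'] := polytime_size Fl.
apply: (@polytime_fold D (fun d => d) (fun _ => Atom 0) l (fun d acc a => Node (dlen acc) acc));
  solve_polytime.
  by apply: polytime_dlen; solve_polytime.
exists (K' * K) => d Dd j; rewrite foldl_lenE.
set s := take _ _; have sl : size s <= dsize d ^ K'.
  apply: leq_trans (HK' d Dd); apply: leq_trans (size_dlist _).
  by rewrite size_take; case: ltnP => // /ltnW.
(* Polynomial bounds are only available from 2 on, while the prefix may be shorter. *)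
have n2 : 2 <= maxn 2 (size s) by lia.
apply: (@leq_trans (maxn 2 (dsize d ^ K') ^ K)); last first.
  case: (K') HK' sl => [|k] HK' sl.
    by have := HK' d Dd; have := dsize_ge2 (l d); rewrite expn0; lia.
  rewrite (maxn_idPr _) ?expnM //.
  by apply: leq_trans (dsize_ge2 d) _; rewrite -{1}(expn1 (dsize d)) leq_pexp2l //; have :=
    dsize_ge2 d; lia.
apply: (@leq_trans (maxn 2 (size s) ^ K)); last by case: (K) => // k; rewrite leq_exp2r //; lia.
apply: leq_trans (HK _ n2).
apply: leq_trans (dsize_enc_seq (B := maxn 2 (size s) + 2) _) _.
  move=> i; rewrite size_rev size_map size_iota => is_.
  rewrite -map_rev (nth_map 0) ?size_rev ?size_iota // nth_rev ?size_iota // nth_iota /=;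
    last by lia.
  apply: leq_trans (_ : (size s).+2 <= _); last by lia.
  apply: leq_trans (bitsize_le (b := size s) _) _; last by lia.
  have := ltn_expl (size s) (ltnSn 1); rewrite expnS; lia.
by rewrite size_rev size_map size_iota; nia.
Qed.

Lemma polytime_pred_dmem D u K : polytime D u -> polytime D K ->
  polytime_pred D (fun d => dmem (u d) (K d)).
Proof. by apply: (polytime_app2 (F := fun u K => of_bool (dmem u K))); rewrite /dmem;
  solve_polytime. Qed.

Lemma polytime_pred_dadj D A u v : polytime D A -> polytime D u -> polytime D v ->
  polytime_pred D (fun d => dadj (A d) (u d) (v d)).
Proof.
apply: (polytime_app3 (F := fun A u v => of_bool (dadj A u v))); rewrite /dadj; solve_polytime.
by do 2!(apply: polytime_dnth; solve_polytime).
Qed.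

Lemma polytime_pred_dpos D W u : polytime D W -> polytime D u ->
  polytime_pred D (fun d => dpos (W d) (u d)).
Proof.
by apply: (polytime_app2 (F := fun W u => of_bool (dpos W u))); rewrite /dpos; solve_polytime;
  apply: polytime_dnth; solve_polytime.
Qed.

Ltac polytime_hook ::=
  lazymatch goal with
  | |- polytime _ (fun d => dnth _ _) => apply: polytime_dnth
  | |- polytime _ (fun d => diota _) => apply: polytime_diota
  | |- polytime _ (fun d => of_bool (dmem _ _)) => apply: polytime_pred_dmem
  | |- polytime _ (fun d => of_bool (dadj _ _ _)) => apply: polytime_pred_dadj
  | |- polytime _ (fun d => of_bool (dpos _ _)) => apply: polytime_pred_dpos
  end.

Lemma polytime_dscaled D ws vs u : polytime D ws -> polytime D vs -> polytime D u ->
  polytime D (fun d => dscaled (ws d) (vs d) (u d)).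
Proof.
apply: polytime_app3; rewrite /dscaled; solve_polytime.
have [K HK] : exists K, forall x, any_data x ->
    dsize (dsnd (dnth (dfst (dfst x)) (dsnd x))) <= dsize x ^ K.
  by apply: polytime_size; solve_polytime.
exists K => d acc a; case: ifP => _; first exact: leq_addr.
apply: leq_trans (dsize_dmul _ _) _; rewrite leq_add2l.
exact: (HK (Node d a) I).
Qed.

Lemma polytime_dnbrs D A vs W v : polytime D A -> polytime D vs -> polytime D W -> polytime D v ->
  polytime D (fun d => dnbrs (A d) (vs d) (W d) (v d)).
Proof. by apply: polytime_app4; rewrite /dnbrs; solve_polytime. Qed.

Lemma polytime_dcands D A vs W : polytime D A -> polytime D vs -> polytime D W ->
  polytime D (fun d => dcands (A d) (vs d) (W d)).
Proof. by apply: polytime_app3; rewrite /dcands; solve_polytime; apply: polytime_dnbrs;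
  solve_polytime. Qed.

Lemma polytime_dclique D A R : polytime D A -> polytime D R ->
  polytime D (fun d => dclique (A d) (R d)).
Proof.
apply: polytime_app2; rewrite /dclique; solve_polytime; exists 1 => d acc a; rewrite expn1.
by case: ifP => _ /=; lia.
Qed.

Lemma polytime_drest D A R : polytime D A -> polytime D R ->
  polytime D (fun d => drest (A d) (R d)).
Proof. by apply: polytime_app2; rewrite /drest; solve_polytime; apply: polytime_dclique;
  solve_polytime. Qed.

Lemma dsize_filter P l : dsize (enc_seq (filter P (dlist l))) <= dsize l.
Proof.
elim: l => [z|a _ b IH] //=; case: ifP => _ /=; lia.
Qed.

(** The remaining list only shrinks, being filtered, and the counter gains at most the size of the
    constant 1. *)
Lemma polytime_dcount D A N : polytime D A -> polytime D N ->
  polytime D (fun d => dcount (A d) (N d)).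
Proof.
apply: polytime_app2; rewrite /dcount; solve_polytime; first by apply: polytime_drest;
  solve_polytime.
exists 1 => d acc a; rewrite expn1; case: ifP => _; first exact: leq_addr.
have : dsize (drest (dfst d) (dfst acc)) <= dsize (dfst acc) by apply: dsize_filter.
have : dsize (dadd (dsnd acc) (Atom 1)) <= dsize (dsnd acc) + 2.
  by apply: leq_trans (dsize_dadd _ _) _.
have := dsize_ge2 d; have := dsize_ge2 a.
by case: acc => [z|x y]; rewrite [dsize (Node _ _)]/=;
  [move: (bitsize_ge2 z) => /=; rewrite (_ : bitsize 0 = 2) // | move=> /=]; lia.
Qed.

Lemma polytime_dratio D W v N k : polytime D W -> polytime D v -> polytime D N -> polytime D k ->
  polytime D (fun d => dratio (W d) (v d) (N d) (k d)).
Proof.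
apply: polytime_app4; rewrite /dratio; solve_polytime.
have [K HK] : exists K, forall x, any_data x ->
    dsize (dmul (dsnd (dsnd (dsnd (dfst x)))) (dnth (dfst (dfst x)) (dsnd x))) <= dsize x ^ K.
  by apply: polytime_size; solve_polytime.
exists K => d acc a; case: ifP => _; first exact: leq_addr.
exact: leq_trans (HK (Node d a) I) (leq_addl _ _).
Qed.

Lemma polytime_dupdate D vs W v N k : polytime D vs -> polytime D W -> polytime D v ->
  polytime D N -> polytime D k ->
  polytime D (fun d => dupdate (vs d) (W d) (v d) (N d) (k d)).
Proof.
by apply: polytime_app5; rewrite /dupdate; solve_polytime; rewrite /dreduce; solve_polytime;
  apply: polytime_dratio; solve_polytime.
Qed.

Lemma polytime_dstep_at D A vs W v : polytime D A -> polytime D vs -> polytime D W ->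
  polytime D v ->
  polytime D (fun d => dstep_at (A d) (vs d) (W d) (v d)).
Proof.
apply: polytime_app4; rewrite /dstep_at; apply: polytime_dupdate; solve_polytime;
  first by apply: polytime_dnbrs; solve_polytime.
by apply: polytime_dcount; solve_polytime; apply: polytime_dnbrs; solve_polytime.
Qed.

Lemma polytime_dstep D A vs S : polytime D A -> polytime D vs -> polytime D S ->
  polytime D (fun d => dstep (A d) (vs d) (S d)).
Proof.
apply: polytime_app3; rewrite /dstep; solve_polytime; first [apply: polytime_dstep_at | idtac];
  solve_polytime; apply: polytime_dcands; solve_polytime.
Qed.

Lemma polytime_dprune D A vs W Rm v : polytime D A -> polytime D vs -> polytime D W ->
  polytime D Rm -> polytime D v ->
  polytime D (fun d => dprune (A d) (vs d) (W d) (Rm d) (v d)).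
Proof. by apply: polytime_app5; rewrite /dprune; solve_polytime. Qed.

Lemma polytime_doutput D A vs S : polytime D A -> polytime D vs -> polytime D S ->
  polytime D (fun d => doutput (A d) (vs d) (S d)).
Proof.
apply: polytime_app3; rewrite /doutput; solve_polytime; first by apply: polytime_dprune;
  solve_polytime.
exists 1 => d acc a; rewrite expn1 /dprune.
by case: ifP => _ /=; lia.
Qed.

Lemma polytime_dstart D : polytime D dstart.
Proof. by rewrite /dstart; solve_polytime; apply: polytime_dscaled; solve_polytime. Qed.

(* Repeated multiplication by the clique counts prevents a bound that is local *)
(* to one step, hence the hypothesis on the whole run.                         *)
Lemma polytime_dwvc D :
  (exists K, forall d, D d -> forall j,
    dsize (foldl (fun S _ => dstep (dsnd d) (diota (dfst d)) S) (Node (dstart d) (Atom 0))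
      (take j (dlist (diota (dfst d))))) <= dsize d ^ K) ->
  polytime D dwvc.
Proof.
move=> H; rewrite /dwvc; apply: polytime_doutput; solve_polytime.
rewrite /dloop; apply: (@polytime_fold D (fun d => d) (fun d => Node (dstart d) (Atom 0))
  (fun d => diota (dfst d)) (fun d S _ => dstep (dsnd d) (diota (dfst d)) S)) => //;
    solve_polytime.
- by apply: polytime_dstep; solve_polytime.
- exact: polytime_dstart.
Qed.

(** * Local ratio *)

Section LocalRatio.
Variables (V : finType) (e : rel V).
Hypotheses (e_sym : symmetric e) (e_irr : irreflexive e).

Lemma vertex_coverP (X : {set V}) :
  reflect (forall x y, e x y -> (x \in X) || (y \in X)) (vertex_cover e X).
Proof.
apply: (iffP forallP) => H x.
  move=> y exy; have /forallP/(_ y) := H x; rewrite /delete /= exy andbT.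
  by rewrite -negb_or negbK.
apply/forallP => y; rewrite /delete /=; apply/negP => /and3P[nx ny exy].
by have := H x y exy; rewrite (negbTE nx) (negbTE ny).
Qed.

(** Both vertices survive in the component of [v], which is a clique. *)
Lemma cluster_deletion_nbrs (M : {set V}) v x y : cluster_deletion e M ->
  v \notin M -> x \notin M -> y \notin M -> e v x -> e v y -> x != y -> e x y.
Proof.
move=> /forallP/(_ x)/forallP/(_ y) H vM xM yM evx evy xy.
suff : delete e M x y by case/and3P.
move: H; rewrite xy /= => /implyP; apply.
by apply: (connect_trans (y := v)); apply: connect1;
  rewrite /delete /= ?vM ?xM ?yM ?(e_sym x).
Qed.

(** * Greedy partition into cliques *)

Definition greedy_clique (R : seq V) : seq V :=
  foldl (fun K u => if all (e u) K then u :: K else K) [::] R.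

Definition outside_clique (R : seq V) := [seq u <- R | u \notin greedy_clique R].

Lemma greedy_clique_rcons R u : greedy_clique (rcons R u) =
  if all (e u) (greedy_clique R) then u :: greedy_clique R else greedy_clique R.
Proof. by rewrite /greedy_clique -cats1 foldl_cat. Qed.

Lemma greedy_clique_sub R : {subset greedy_clique R <= R}.
Proof.
elim/last_ind: R => // R u IH x; rewrite greedy_clique_rcons mem_rcons inE.
by case: ifP => _; rewrite ?inE; [case/orP=> [->//|/IH ->] | move/IH ->]; rewrite orbT.
Qed.

Lemma greedy_clique_adj R : {in greedy_clique R &, forall x y, x != y -> e x y}.
Proof.
elim/last_ind: R => // R u IH x y; rewrite greedy_clique_rcons.
case: ifP => [/allP a|_]; last exact: IH.
rewrite !inE => /orP[/eqP->|xK] /orP[/eqP->|yK]; first by rewrite eqxx.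
- by move=> _; apply: a.
- by move=> _; rewrite e_sym; apply: a.
exact: IH.
Qed.

(** A rejected vertex had a non-neighbour in the clique built so far, and the clique never loses a
    vertex. *)
Lemma greedy_clique_max R u : u \in R -> u \notin greedy_clique R ->
  exists2 x, x \in greedy_clique R & ~~ e u x.
Proof.
elim/last_ind: R => // R w IH; rewrite greedy_clique_rcons mem_rcons inE.
case: ifP => [a | /negbT/allPn[x xK nx]].
  rewrite inE negb_or => /orP[/eqP->|uR] /andP[uw uK]; first by rewrite eqxx in uw.
  by have [x xK nx] := IH uR uK; exists x => //; rewrite inE xK orbT.
by case/orP=> [/eqP->|uR] uK; [exists x | apply: IH].
Qed.

(** The greedy clique of a nonempty list is nonempty: it contains the head, or else the
    non-neighbour that caused the rejection of the head. *)
Lemma outside_clique_lt R : R != [::] -> size (outside_clique R) < size R.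
Proof.
case: R => // u R _; rewrite ltnNge; apply/negP => H.
have E : size (outside_clique (u :: R)) = size (u :: R).
  by apply/eqP; rewrite eqn_leq H size_filter count_size.
have [x xK] : exists x, x \in greedy_clique (u :: R).
  case: (boolP (u \in greedy_clique (u :: R))) => [uK|uK]; first by exists u.
  by have [x xK _] := greedy_clique_max (mem_head u R) uK; exists x.
move/eqP: E; rewrite size_filter -all_count => /allP/(_ x (greedy_clique_sub xK)).
by rewrite xK.
Qed.

(** [m] is fuel; by [outside_clique_lt] the length of [R] is enough. *)
Fixpoint clique_count m (R : seq V) : nat :=
  if m is m'.+1 then (if R is [::] then 0 else (clique_count m' (outside_clique R)).+1) else 0.

Lemma clique_countS m R : R != [::] ->
  clique_count m.+1 R = (clique_count m (outside_clique R)).+1.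
Proof. by case: R. Qed.

Lemma count_clique (P : pred V) R : count P R =
  count P [seq u <- R | u \in greedy_clique R] + count P (outside_clique R).
Proof.
rewrite /outside_clique; move: (greedy_clique R) => K.
by elim: R => //= u R ->; case: (u \in K) => /=; lia.
Qed.

Lemma all_leq_count (P : pred V) s : all P s -> size s <= count P s.
Proof. by rewrite all_count => /eqP ->. Qed.

Lemma count_le1 (P : pred V) s : uniq s ->
  {in s &, forall x y, P x -> P y -> x = y} -> count P s <= 1.
Proof.
elim: s => //= x s IH /andP[xs us] H.
case Px: (P x); last by apply: IH => // y z ys zs; apply: H; rewrite inE (ys, zs) orbT.
rewrite addnC addn1 ltnS leqn0 eqn0Ngt -has_count; apply/negP => /hasP[y ys Py].
have xy : x = y by apply: H => //; rewrite inE ?eqxx ?ys ?orbT.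
by rewrite xy ys in xs.
Qed.

(** An independent set meets each clique of the partition at most once. *)
Lemma clique_count_indep m R (P : pred V) : uniq R -> size R <= m ->
  {in R &, forall x y, P x -> P y -> ~~ e x y} -> count P R <= clique_count m R.
Proof.
elim: m R => [|m IH] R uR Rm H; first by rewrite leqn0 in Rm; rewrite (size0nil (eqP Rm)).
case: (eqVneq R [::]) => [-> //|R0].
rewrite (clique_countS _ R0).
rewrite count_clique -add1n leq_add //.
  apply: count_le1; first exact: filter_uniq.
  move=> x y; rewrite !mem_filter => /andP[xK xR] /andP[yK yR] Px Py.
  by apply/eqP; apply/negPn/negP => /(greedy_clique_adj xK yK) exy; have := H x y xR yR Px Py;
    rewrite exy.
apply: IH; first exact: filter_uniq.
  by have := outside_clique_lt R0; lia.
by move=> x y; rewrite !mem_filter => /andP[_ xR] /andP[_ yR]; apply: H.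
Qed.

Lemma clique_count_size m R : clique_count m R <= size R.
Proof.
elim: m R => [|m IH] R //; case: (eqVneq R [::]) => [-> //|R0].
by rewrite (clique_countS _ R0) (leq_ltn_trans (IH _)) ?outside_clique_lt.
Qed.

Lemma clique_count_gt0 m R : 0 < m -> R != [::] -> 0 < clique_count m R.
Proof. by case: m R => [|m] [|u R]. Qed.

(** Let [P] be a clique. If it misses a vertex of the first greedy clique, that vertex pays for this
    clique and induction handles the rest. If it contains the whole greedy clique, maximality keeps
    it from all remaining vertices, which are at least as many as the remaining cliques. *)
Lemma clique_count_clique m R (P : pred V) : uniq R -> size R <= m ->
  {in R &, forall x y, P x -> P y -> x != y -> e x y} ->
  clique_count m R <= (count (predC P) R).+1.
Proof.
elim: m R => [|m IH] R uR Rm H //.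
case: (eqVneq R [::]) => [-> //|R0].
rewrite (clique_countS _ R0).
rewrite ltnS count_clique.
case: (boolP (all P (greedy_clique R))) => [/allP KP | /allPn[x xK nPx]].
  apply: leq_trans (clique_count_size _ _) _; apply: leq_trans (leq_addl _ _).
  apply/all_leq_count/allP => u; rewrite mem_filter => /andP[uK Ru].
  have [x xK nux] := greedy_clique_max Ru uK; apply/negP => Pu.
  case/negP: nux; apply: H => //; [exact: greedy_clique_sub | exact: KP |].
  by apply: contraNneq uK => ->.
apply: (@leq_trans (count (predC P) (outside_clique R)).+1).
  apply: IH; first exact: filter_uniq.
    by have := outside_clique_lt R0; lia.
  by move=> x' y; rewrite !mem_filter => /andP[_ xR] /andP[_ yR]; apply: H.
rewrite -add1n leq_add2r -has_count; apply/hasP; exists x => //.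
by rewrite mem_filter xK greedy_clique_sub.
Qed.

(** * Weights of stars *)

Definition star (v : V) (N : seq V) (k : nat) (X : {set V}) : nat :=
  k * (v \in X) + count (mem X) N.

(** A cover without [v] contains [N]. A cover with [v] gains [k] there, and what it misses in [N] is
    independent, hence at most [k] vertices. *)
Lemma star_vertex_cover v N C (k := clique_count (size N) N) : uniq N -> all (e v) N ->
  vertex_cover e C -> size N <= star v N k C.
Proof.
move=> uN /allP eN /vertex_coverP vc; rewrite /star.
case: (boolP (v \in C)) => vC; last first.
  rewrite muln0 add0n; apply/all_leq_count/allP => u uN'.
  by have := vc v u (eN u uN'); rewrite (negbTE vC).
rewrite muln1 -(count_predC (mem C) N) addnC leq_add2r.
apply: clique_count_indep => // x y _ _ /= xC yC.
by apply/negP => /vc; rewrite (negbTE xC) (negbTE yC).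
Qed.

(** If [v] is deleted, it alone weighs [k]. Otherwise the surviving part of [N] is a clique, and
    [clique_count_clique] applies. *)
Lemma star_cluster_deletion v N M (k := clique_count (size N) N) : uniq N -> all (e v) N ->
  cluster_deletion e M -> k <= (star v N k M).+1.
Proof.
move=> uN /allP eN cd; rewrite /star.
case: (boolP (v \in M)) => vM; first by rewrite muln1; lia.
rewrite muln0 add0n.
rewrite (@eq_count _ (mem M) (predC (fun x => x \notin M))); last by move=> x; rewrite /= negbK.
apply: clique_count_clique => // x y xN yN xM yM.
by apply: (cluster_deletion_nbrs cd vM) => //; apply: eN.
Qed.

Lemma star_upper v N k (X : {set V}) : 0 < k -> ~~ ((v \in X) && all (mem X) N) ->
  star v N k X < size N + k.
Proof.
move=> k0; rewrite /star; case: (v \in X) => /= H; last by have := count_size (mem X) N; lia.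
have : count (mem X) N < size N by rewrite ltn_neqAle -all_count H count_size.
by lia.
Qed.

(** * Reduction of integer weights, and pruning *)

Local Open Scope ring_scope.

Definition weightZ (f : V -> int) (X : {set V}) : int := \sum_(x in X) f x.

Definition nbrs (f : V -> int) v := [seq u <- enum V | e v u && (0 < f u)].
Definition cands f := [seq v <- enum V | (0 < f v) && (nbrs f v != [::])].
(** After multiplying all weights by [k], subtracting [r] stars leaves them nonnegative when [r] is
    at most [f v] and at most [k] times each weight on [N]. The fold takes the minimum of these
    bounds. *)
Definition removable (f : V -> int) v (N : seq V) (k : nat) : int :=
  foldl (fun acc u => if acc <= k%:Z * f u then acc else k%:Z * f u) (f v) N.
Definition reduce (f : V -> int) v (N : seq V) (k : nat) r u : int :=
  k%:Z * f u - (if u == v then k%:Z * r else if u \in N then r else 0).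
Definition reduce_at f v :=
  let N := nbrs f v in let k := clique_count (size N) N in
  reduce f v N k (removable f v N k).
Definition step (S : (V -> int) * seq V) :=
  if cands S.1 is v :: _ then (reduce_at S.1 v, v :: S.2) else S.

Lemma weightZ_reduce f v N k r X : uniq N -> v \notin N ->
  weightZ (reduce f v N k r) X = k%:Z * weightZ f X - r * (star v N k X)%:Z.
Proof.
move=> uN vN; rewrite /weightZ /reduce sumrB -mulr_sumr; congr (_ - _).
(* Since [v] is not in [N], the nested conditional is [r] times a sum of two indicators. *)
rewrite (eq_bigr (fun u => r * (k%:Z * (u == v)%:Z + (u \in N)%:Z))); last first.
  move=> u _; case: (eqVneq u v) => [->|_]; first by rewrite (negbTE vN); lia.
  by case: (u \in N); lia.
rewrite -mulr_sumr big_split /= -mulr_sumr /star PoszD PoszM.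
congr (_ * (_ * _ + _)).
  case: (boolP (v \in X)) => vX.
    rewrite (bigD1 v) //= eqxx big1 ?addr0 // => u /andP[_ /negbTE ->] //.
  by rewrite big1 // => u uX; case: eqP => // E; rewrite -E uX in vX.
transitivity (\sum_(u <- N) (u \in X)%:Z).
  rewrite big_uniq //= big_mkcond [RHS]big_mkcond /=.
  by apply: eq_bigr => u _; case: (u \in X); case: (u \in N).
by elim: (N) => [|u s IH]; rewrite ?big_nil // big_cons IH /= PoszD.
Qed.

(** The final disjunction records where the minimum is attained: that vertex becomes null. *)
Lemma removable_props (f : V -> int) v N k : (0 < k)%N -> 0 < f v -> {in N, forall u, 0 < f u} ->
  let r := removable f v N k in
  [/\ 0 < r, r <= f v, {in N, forall u, r <= k%:Z * f u}
    & r = f v \/ exists2 u, u \in N & r = k%:Z * f u].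
Proof.
move=> k0 fv; elim/last_ind: N => [|N u IH] fN /=; first by split => //; left.
have [|r0 rv rN req] := IH; first by move=> x xN; apply: fN; rewrite mem_rcons inE xN orbT.
rewrite /removable -cats1 foldl_cat /= -/(removable f v N k); set r :=
  removable f v N k in r0 rv rN req *.
have fu : 0 < f u by apply: fN; rewrite mem_rcons inE eqxx.
case: (leP r) => ru; split => //.
- by move=> x; rewrite mem_cat mem_seq1 => /orP[/rN //|/eqP ->].
- by case: req => [|[x xN E]]; [left | right; exists x => //; rewrite mem_cat xN].
- by nia.
- exact: le_trans (ltW ru) rv.
- move=> x; rewrite mem_cat mem_seq1 => /orP[/rN|/eqP -> //]; exact: le_trans (ltW ru).
- by right; exists u => //; rewrite mem_cat mem_seq1 eqxx orbT.
Qed.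

Definition prune (X : {set V}) v := if [forall u, e v u ==> (u \in X)] then X :\ v else X.

(** The edges at [v] stay covered by their other ends, which differ from [v] by irreflexivity. *)
Lemma prune_vertex_cover (X : {set V}) v : vertex_cover e X -> vertex_cover e (prune X v).
Proof.
rewrite /prune; case: ifP => // /forallP H /vertex_coverP vc; apply/vertex_coverP => x y exy.
rewrite !inE; case: (eqVneq x v) => [xv|xv]; case: (eqVneq y v) => [yv|yv] /=.
- by rewrite xv yv e_irr in exy.
- by have := H y; rewrite -xv exy.
- by have := H x; rewrite -yv e_sym exy orbF.
exact: vc.
Qed.

Lemma prune_sub (X : {set V}) v : prune X v \subset X.
Proof. by rewrite /prune; case: ifP => _ //; apply: subsetDl. Qed.

Lemma weightZ_sub (f : V -> int) (X Y : {set V}) : (forall x, 0 <= f x) -> X \subset Y ->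
  weightZ f X <= weightZ f Y.
Proof.
move=> f0 XY; rewrite /weightZ [leRHS](bigID (fun x => x \in X)) /=.
have -> : \sum_(x in X) f x = \sum_(x in Y | x \in X) f x.
  apply: eq_bigl => x; case: (boolP (x \in X)) => [xX|_]; last by rewrite andbF.
  by rewrite (subsetP XY).
by rewrite lerDl sumr_ge0.
Qed.

Lemma weightZ_ge0 (f : V -> int) (X : {set V}) : (forall x, 0 <= f x) -> 0 <= weightZ f X.
Proof. by move=> f0; apply: sumr_ge0. Qed.

(* Pruning [X] in the order of the stack turns a good cover for the current    *)
(* weights into a good cover for the initial weights [f0].                     *)
Definition loop_inv f0 (f : V -> int) (st : seq V) := forall X : {set V},
  vertex_cover e X -> (forall x, f x = 0 -> x \in X) ->
  (forall C M, vertex_cover e C -> cluster_deletion e M ->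
    weightZ f X <= weightZ f C + weightZ f M) ->
  vertex_cover e (foldl prune X st) /\
  (forall C M, vertex_cover e C -> cluster_deletion e M ->
    weightZ f0 (foldl prune X st) <= weightZ f0 C + weightZ f0 M).

Lemma reduce_at_props (f : V -> int) v : (forall x, 0 <= f x) -> v \in cands f ->
  [/\ forall x, 0 <= reduce_at f v x,
      forall x, f x = 0 -> reduce_at f v x = 0,
      exists2 x, 0 < f x & reduce_at f v x = 0,
      forall x, reduce_at f v x <= (size (nbrs f v))%:Z * f x &
      forall f0 st, loop_inv f0 f st -> loop_inv f0 (reduce_at f v) (v :: st)].
Proof.
move=> f_ge0; rewrite mem_filter => /andP[/andP[fv N0] _].
rewrite /reduce_at; set N := nbrs f v in N0 *; set k := clique_count _ _; set r :=
  removable f v N k.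
have N_pos : {in N, forall u, 0 < f u} by move=> u; rewrite mem_filter => /andP[/andP[]].
have N_adj : all (e v) N by apply/allP => u; rewrite mem_filter => /andP[/andP[]].
have uN : uniq N by apply: filter_uniq; apply: enum_uniq.
have vN : v \notin N by apply/negP => /(allP N_adj); rewrite e_irr.
have k0 : (0 < k)%N by apply: clique_count_gt0 => //; case: (N) N0.
have kN : (k <= size N)%N by apply: clique_count_size.
have [r0 rv rN req] := removable_props k0 fv N_pos; rewrite -/r in r0 rv rN req.
have red_ge0 x : 0 <= reduce f v N k r x.
  rewrite /reduce subr_ge0; case: eqP => [->|_]; first by rewrite ler_pM2l.
  by case: ifP => [/rN //|_]; rewrite mulr_ge0.
have red_le x : reduce f v N k r x <= (size N)%:Z * f x.
  apply: (@le_trans _ _ (k%:Z * f x)); last by rewrite ler_wpM2r // lez_nat.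
  by rewrite gerBl; case: eqP => _; [rewrite mulr_ge0 // ltW | case: ifP => // _; apply: ltW].
have red0 x : f x = 0 -> reduce f v N k r x = 0.
  by move=> fx; apply/eqP; rewrite eq_le red_ge0 (le_trans (red_le x)) // fx mulr0.
split => //.
  case: req => [->|[u Nu ->]]; first by exists v => //; rewrite /reduce eqxx subrr.
  exists u; first exact: N_pos.
  rewrite /reduce Nu; case: eqP => [E|_]; last by rewrite subrr.
  by rewrite -E Nu in vN.
move=> f0 st inv X vcX X0 HX; apply: inv => [|x fx|C M vcC cdM].
- exact: prune_vertex_cover.
- rewrite /prune; case: ifP => _; rewrite ?inE X0 ?red0 // andbT.
  by apply: contraTneq fv => <-; rewrite fx.
(* Scaled by [k], the old weight is the reduced weight plus [r] stars, so the two parts can be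
   compared separately. *)
rewrite -(ler_pM2l (_ : 0 < k%:Z)) // mulrDr.
have W Y : k%:Z * weightZ f Y = weightZ (reduce f v N k r) Y + r * (star v N k Y)%:Z.
  by rewrite weightZ_reduce // subrK.
rewrite !W.
have H1 : weightZ (reduce f v N k r) (prune X v) <=
  weightZ (reduce f v N k r) C + weightZ (reduce f v N k r) M.
  by apply: le_trans (HX C M vcC cdM); apply: weightZ_sub => //; apply: prune_sub.
have H2 := star_vertex_cover uN N_adj vcC; have H3 := star_cluster_deletion uN N_adj cdM.
have H4 : (star v N k (prune X v) < size N + k)%N.
  (* If [v] was not dropped, it has a neighbour outside [X]. As [X] contains all null vertices, this
     neighbour has positive weight, so it is a leaf of the star that the set misses. *)
  apply: star_upper => //; apply/negP => /andP[vX /allP NX].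
  move: vX NX; rewrite /prune; case: ifP => [_|]; first by rewrite !inE eqxx.
  move=> /negbT; rewrite negb_forall => /existsP[u]; rewrite negb_imply => /andP[evu uX] _ NX.
  case: (eqVneq (f u) 0) => [fu|fu]; first by rewrite X0 ?red0 in uX.
  have /NX : u \in N by rewrite mem_filter evu mem_enum lt_def fu f_ge0.
  by rewrite /= (negbTE uX).
rewrite -/k in H2 H3.
have H5 : r * (star v N k (prune X v))%:Z <= r * (star v N k C)%:Z + r * (star v N k M)%:Z.
  by rewrite -mulrDr ler_pM2l //; lia.
by apply: le_trans (lerD H1 H5) _; rewrite addrACA.
Qed.

(** Null vertices stay null and each effective step adds one, so [j] steps without termination leave
    at least [j] of them. *)
Lemma reduce_sound (f0 : V -> int) j :
  (forall x, 0 <= f0 x) ->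
  let S := iter j step (f0, [::]) in
  [/\ forall x, 0 <= S.1 x, loop_inv f0 S.1 S.2 &
      cands S.1 = [::] \/ (j <= #|[set x | S.1 x == 0]|)%N].
Proof.
move=> f0_ge0; elim: j => [|j [S_ge0 inv prog]] /=.
  by split; [| move=> X vcX _ H | right].
case: (iter j _ _) S_ge0 inv prog => f st /= f_ge0 inv prog; rewrite /step /=.
case E: (cands f) => [|v s] /=; first by split => //; left.
have vc : v \in cands f by rewrite E mem_head.
have [red_ge0 red0 [x fx rx] _ red_inv] := reduce_at_props f_ge0 vc.
split => //; first exact: red_inv.
right; case: prog => [E0|prog]; first by rewrite E0 in E.
apply: leq_ltn_trans prog _; apply: proper_card; apply/properP; split.
  by apply/subsetP => y; rewrite !inE => /eqP/red0 ->.
by exists x; rewrite !inE ?rx // gt_eqF.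
Qed.

Lemma reduce_final (f0 : V -> int) : (forall x, 0 <= f0 x) ->
  let S := iter #|V| step (f0, [::]) in
  let X := foldl prune [set x | ~~ (0 < S.1 x)] S.2 in
  vertex_cover e X /\ forall C M, vertex_cover e C -> cluster_deletion e M ->
    weightZ f0 X <= weightZ f0 C + weightZ f0 M.
Proof.
move=> f0_ge0 S; have [S_ge0 inv prog] := reduce_sound #|V| f0_ge0; rewrite -/S in S_ge0 inv prog.
apply: inv.
- apply/vertex_coverP => x y exy; rewrite !inE -negb_and; apply/negP => /andP[Sx Sy].
  (* The alternative would make all vertices null, contradicting the positive weight of [x]. *)
  have c0 : cands S.1 = [::].
    case: prog => // H; have /eqP E : [set x | S.1 x == 0] == setT.
      by rewrite eqEcard subsetT cardsT.
    by have := in_setT x; rewrite -E inE gt_eqF.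
  have : x \in cands S.1.
    rewrite mem_filter Sx mem_enum andbT; apply/negP => /eqP N0.
    have : y \in nbrs S.1 x by rewrite mem_filter exy Sy mem_enum.
    by rewrite N0.
  by rewrite c0.
- by move=> x Sx; rewrite inE Sx ltxx.
move=> C M _ _; rewrite [weightZ _ _]big1; first by rewrite addr_ge0 ?weightZ_ge0.
by move=> x; rewrite inE => nS; apply/eqP; rewrite eq_le S_ge0 andbT leNgt.
Qed.
End LocalRatio.

(** * Correctness and size of the encoded run *)

Local Open Scope ring_scope.

Section Encoding.
Variables (n : nat) (e : rel 'I_n) (w : 'I_n -> rat).

Definition enc_vertex (u : 'I_n) := Atom (u : nat)%:Z.
Definition enc_vertices (s : seq 'I_n) := enc_seq (map enc_vertex s).
Definition enc_weights (f : 'I_n -> int) := enc_seq [seq Atom (f u) | u <- enum 'I_n].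
Let A := enc_seq [seq enc_set [set y | e x y] | x <- enum 'I_n].
Let vs := enc_vertices (enum 'I_n).

Lemma dnth_enum (g : 'I_n -> data) u :
  dnth (enc_seq [seq g x | x <- enum 'I_n]) (enc_vertex u) = g u.
Proof.
have un : (u < size [seq g x | x <- enum 'I_n])%N by rewrite size_map size_enum_ord.
rewrite /enc_vertex (dnthE un).
by rewrite (nth_map u) ?size_enum_ord // nth_ord_enum.
Qed.

Lemma diota_enum (l : seq data) : size l = n -> diota (enc_seq l) = vs.
Proof.
by move=> ln; rewrite diotaE enc_seqK ln -val_enum_ord -map_comp.
Qed.

Lemma dadjE u v : dadj A (enc_vertex u) (enc_vertex v) = e u v.
Proof. by rewrite /dadj dnth_enum /enc_set dnth_enum truth_of_bool inE. Qed.

Lemma dposE f u : dpos (enc_weights f) (enc_vertex u) = (0 < f u).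
Proof. by rewrite /dpos dnth_enum. Qed.

Lemma dmemE u K : dmem (enc_vertex u) (enc_vertices K) = (u \in K).
Proof.
rewrite /dmem enc_seqK has_map -has_pred1; apply: eq_has => x /=.
by rewrite /enc_vertex /= eqz_nat.
Qed.

Lemma dnbrsE f v : dnbrs A vs (enc_weights f) (enc_vertex v) = enc_vertices (nbrs e f v).
Proof.
rewrite /dnbrs enc_seqK filter_map; congr (enc_seq (map _ _)).
by apply: eq_filter => u /=; rewrite dadjE dposE.
Qed.

Lemma isatom_enc_vertices s : isatom (enc_vertices s) = (s == [::]).
Proof. by case: s. Qed.

Lemma dcandsE f : dcands A vs (enc_weights f) = enc_vertices (cands e f).
Proof.
rewrite /dcands enc_seqK filter_map; congr (enc_seq (map _ _)).
by apply: eq_filter => u /=; rewrite dnbrsE dposE isatom_enc_vertices.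
Qed.

Lemma dcliqueE R : dclique A (enc_vertices R) = enc_vertices (greedy_clique e R).
Proof.
rewrite /dclique enc_seqK; elim/last_ind: R => // R u IH.
rewrite greedy_clique_rcons -cats1 map_cat foldl_cat /= IH enc_seqK all_map.
rewrite (@eq_all _ _ (e u)) => [|x] /=; last by rewrite dadjE.
by case: ifP.
Qed.

Lemma drestE R : drest A (enc_vertices R) = enc_vertices (outside_clique e R).
Proof.
rewrite /drest enc_seqK filter_map; congr (enc_seq (map _ _)).
by apply: eq_filter => u /=; rewrite dcliqueE dmemE.
Qed.

Lemma dcountE N : dcount A (enc_vertices N) = Atom (clique_count e (size N) N)%:Z.
Proof.
rewrite /dcount enc_seqK.
(* The clock, the remaining list and the counter must vary independently for the induction. *)
suff H : forall (s : seq data) R (c : nat),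
  dsnd (foldl (fun acc _ => if isatom (dfst acc) then acc
  else Node (drest A (dfst acc)) (dadd (dsnd acc) (Atom 1))) (Node (enc_vertices R) (Atom c)) s)
  = Atom (c + clique_count e (size s) R)%N.
  by rewrite H size_map.
elim=> [|a s IH] R c; first by rewrite addn0.
rewrite [foldl _ _ _]/= isatom_enc_vertices; case: eqP => [->|/eqP R0].
  by rewrite IH; case: (size s).
rewrite drestE (_ : dadd _ _ = Atom c.+1); last by rewrite /dadd /=; congr Atom; lia.
by rewrite IH [size _]/= (clique_countS _ _ R0) addnS.
Qed.

Lemma dratioE f v N k :
  dratio (enc_weights f) (enc_vertex v) (enc_vertices N) (Atom k%:Z) = Atom (removable f v N k).
Proof.
rewrite /dratio enc_seqK dnth_enum /removable; move: (f v) => r.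
elim: N r => //= u N IH r; rewrite dnth_enum -IH /dmul /=.
by case: ifP.
Qed.

Lemma dupdateE f v N k : dupdate vs (enc_weights f) (enc_vertex v) (enc_vertices N) (Atom k%:Z)
  = enc_weights (reduce f v N k (removable f v N k)).
Proof.
rewrite /dupdate enc_seqK -map_comp; congr enc_seq; apply: eq_map => u /=.
rewrite /dreduce dratioE dmemE dnth_enum /reduce /= eqz_nat val_eqE.
by rewrite /dsub /dmul /=; case: eqP => // _; case: ifP.
Qed.

Definition enc_state (S : ('I_n -> int) * seq 'I_n) := Node (enc_weights S.1) (enc_vertices S.2).

Lemma dstepE S : dstep A vs (enc_state S) = enc_state (step e S).
Proof.
case: S => f st; rewrite /dstep /step /= dcandsE isatom_enc_vertices.
case: (cands e f) => //= v s.
by rewrite /dstep_at dnbrsE dcountE dupdateE.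
Qed.

Lemma foldl_dstep S (s : seq data) :
  foldl (fun S _ => dstep A vs S) (enc_state S) s = enc_state (iter (size s) (step e) S).
Proof. by elim: s S => //= a s IH S; rewrite dstepE IH -iterSr. Qed.

(** The program accumulates the dropped centres, the abstract algorithm shrinks a cover; the two are
    complementary inside [Z] throughout the stack. *)
Lemma dpruneE f st Rm (Z := [set x | ~~ (0 < f x)]) : exists2 Rm',
  foldl (dprune A vs (enc_weights f)) (enc_vertices Rm) (map enc_vertex st) = enc_vertices Rm' &
  foldl (prune e) (Z :\: [set x in Rm]) st = Z :\: [set x in Rm'].
Proof.
elim: st Rm => [|v st IH] Rm /=; first by exists Rm.
pose c := [forall u, e v u ==> (u \in Z :\: [set x in Rm])].
have -> : dprune A vs (enc_weights f) (enc_vertices Rm) (enc_vertex v)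
  = enc_vertices (if c then v :: Rm else Rm).
  rewrite /dprune enc_seqK all_map; set b := all _ _; suff -> : b = c by case: c.
  apply/allP/forallP => H u; last move=> _; have := H u; rewrite ?mem_enum;
    rewrite /= dadjE dposE dmemE !inE andbC; exact.
have -> : prune e (Z :\: [set x in Rm]) v = Z :\: [set x in if c then v :: Rm else Rm].
  rewrite /prune -/c; case: c => //; apply/setP => x; rewrite !inE negb_or.
  by rewrite andbA.
exact: IH.
Qed.

Lemma doutputE S : doutput A vs (enc_state S) =
  enc_set (foldl (prune e) [set x | ~~ (0 < S.1 x)] S.2).
Proof.
rewrite /doutput /= !enc_seqK.
have [Rm' E1 E2] := dpruneE S.1 S.2 [::].
rewrite (_ : Atom 0 = enc_vertices [::]) // E1.
have -> : foldl (prune e) [set x | ~~ (0 < S.1 x)] S.2 =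
    [set x | ~~ (0 < S.1 x)] :\: [set x in Rm'].
  by rewrite -E2; congr foldl; apply/setP => x; rewrite !inE.
rewrite /enc_set -map_comp; congr enc_seq; apply: eq_map => u /=.
by rewrite dposE dmemE !inE andbC.
Qed.

(** * Clearing denominators *)

Definition scaled u : int := numq (w u) * \prod_(x | x != u) denq (w x).

Lemma dscaledE u : dscaled (enc_seq [seq enc_rat (w x) | x <- enum 'I_n]) vs (enc_vertex u)
  = Atom (scaled u).
Proof.
have E : \prod_(x | x != u) denq (w x) = \prod_(x <- enum 'I_n | x != u) denq (w x).
  by rewrite big_enum_cond.
set ws := enc_seq _.
have Hws x : dnth ws (enc_vertex x) = enc_rat (w x) by apply: dnth_enum.
rewrite /dscaled Hws enc_seqK /dmul /scaled /= E; congr (Atom (_ * _)).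
rewrite -[RHS]mul1r; clearbody ws; move: {1 2}(1 : int) => c.
elim: (enum 'I_n) c => [|x s IH] c /=; first by rewrite big_nil mulr1.
rewrite big_cons eqz_nat val_eqE Hws; case: eqP => _ /=; first exact: IH.
by rewrite IH mulrA.
Qed.

Let ws := enc_seq [seq enc_rat (w x) | x <- enum 'I_n].

Lemma diota_ws : diota ws = vs.
Proof. by apply: diota_enum; rewrite size_map size_enum_ord. Qed.

Lemma dstartE : dstart (enc_graph e w) = enc_weights scaled.
Proof.
rewrite /dstart /= diota_ws enc_seqK -map_comp.
by congr enc_seq; apply: eq_map => u /=; rewrite dscaledE.
Qed.

Lemma dwvcE : dwvc (enc_graph e w) = enc_set
  (let S := iter n (step e) (scaled, [::]) in foldl (prune e) [set x | ~~ (0 < S.1 x)] S.2).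
Proof.
rewrite /dwvc dstartE /= diota_ws /dloop.
rewrite -[Node _ _]/(enc_state (scaled, [::])) foldl_dstep enc_seqK size_map size_enum_ord.
exact: doutputE.
Qed.

Lemma scaledE u : (scaled u)%:~R = w u * (\prod_x denq (w x))%:~R.
Proof.
rewrite [X in _ = _ * X%:~R](bigD1 u) //= /scaled !intrM mulrA; congr (_ * _).
by rewrite -{2}(divq_num_den (w u)) divfK // intr_eq0 denq_eq0.
Qed.

Lemma weightZ_scaled X : (weightZ scaled X)%:~R = weight w X * (\prod_x denq (w x))%:~R.
Proof.
rewrite /weightZ /weight rmorph_sum /= mulr_suml; apply: eq_bigr => u _.
exact: scaledE.
Qed.

(** * Size of the states of the main loop *)

Hypothesis w_ge0 : forall v, 0 <= w v.

Lemma den_gt0 : 0 < \prod_x denq (w x).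
Proof. by apply: prodr_gt0 => x _; apply: denq_gt0. Qed.

Lemma scaled_ge0 u : 0 <= scaled u.
Proof.
by rewrite mulr_ge0 ?numq_ge0 //; apply/ltW/prodr_gt0 => x _; apply: denq_gt0.
Qed.

Hypotheses (e_sym : symmetric e) (e_irr : irreflexive e).

(** The subtraction only lowers nonnegative weights, so a step multiplies them by at most the degree
    of the centre, hence by at most [n], and adds at most [n + 2] bits. *)
Lemma bitsize_state j u (B : nat) : (bitsize (scaled u) <= B)%N ->
  (bitsize ((iter j (step e) (scaled, [::])).1 u) <= B + j * (n + 2))%N.
Proof.
move=> HB; elim: j => [|j IH]; first by rewrite addn0.
have [S_ge0 _ _] := reduce_sound e_sym e_irr j scaled_ge0.
rewrite iterS; case: (iter j _ _) IH S_ge0 => f st /= IH f_ge0.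
rewrite /step /=; case E: (cands e f) => [|v s] /=; first by lia.
have vc : v \in cands e f by rewrite E mem_head.
have [r_ge0 _ _ r_le _] := reduce_at_props e_sym e_irr f_ge0 vc.
have sN : (size (nbrs e f v) <= n)%N.
  by rewrite -[leqRHS]size_enum_ord size_filter count_size.
apply: (@leq_trans (bitsize (n%:Z * f u))).
  apply: bitsize_mono; rewrite -lez_nat !gez0_abs ?mulr_ge0 //.
  by apply: le_trans (r_le u) _; rewrite ler_wpM2r // lez_nat.
apply: leq_trans (bitsizeM _ _) _.
have : (bitsize n <= n.+2)%N.
  by apply: bitsize_le; rewrite absz_nat (ltn_trans (ltn_expl n (ltnSn 1))) // ltn_exp2l.
by rewrite mulSn; move: IH; clear; lia.
Qed.

Lemma size_stack j S : (size (iter j (step e) S).2 <= size S.2 + j)%N.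
Proof.
elim: j => [|j IH]; first by rewrite addn0.
rewrite iterS; case: (iter j _ _) IH => f st /=; rewrite /step /=.
by case: (cands e f) => [|v s] /=; lia.
Qed.

Lemma dsize_enc_state j (B : nat) : (j <= n)%N -> (dsize (enc_weights scaled) <= B)%N ->
  (dsize (enc_state (iter j (step e) (scaled, [::]))) <=
   n * (B + n * (n + 2)).+1 + n * (n + 3) + 5)%N.
Proof.
move=> jn HB.
have n2 u : (bitsize (u : 'I_n) <= n.+2)%N.
  apply: bitsize_le; rewrite absz_nat (ltn_trans (ltn_ord u)) //.
  by rewrite (ltn_trans (ltn_expl n (ltnSn 1))) // ltn_exp2l.
have HW : (dsize (enc_weights (iter j (step e) (scaled, [::])).1) <=
  n * (B + n * (n + 2)).+1 + 2)%N.
  rewrite -{1}[n in (n * _.+1)%N]size_enum_ord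
    -(size_map (fun u => Atom ((iter j (step e) (scaled, [::])).1 u))).
  apply: dsize_enc_seq => i; rewrite size_map => il.
  (* Any vertex will do: it only serves as the default of [nth]. *)
  have u := Ordinal (leq_trans il (eq_leq (size_enum_ord n))).
  rewrite (nth_map u) //=.
  apply: leq_trans (bitsize_state _ (B := B) _) _; last by rewrite leq_add2l leq_mul2r jn orbT.
  apply: leq_trans HB.
  have : nth u (enum 'I_n) i \in enum 'I_n by apply: mem_nth.
  rewrite /enc_weights; elim: (enum 'I_n) (nth _ _ _) => //= x s IH y.
  by rewrite inE => /orP[/eqP ->|/IH]; lia.
have HS : (dsize (enc_vertices (iter j (step e) (scaled, [::])).2) <= n * (n + 3) + 2)%N.
  set st := (iter _ _ _).2.
  have sn : (size st <= n)%N by apply: leq_trans (size_stack _ _) _.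
  apply: leq_trans (dsize_enc_seq (B := n.+2) _) _.
    move=> i; rewrite size_map => il; case: st {sn} il => // x s il.
    by rewrite (nth_map x) //=; apply: n2.
  by rewrite size_map leq_add2r -addn3 leq_mul2r sn orbT.
move: HW HS; case: (iter _ _ _) => f st /=; set p := dsize _; set q := dsize _; lia.
Qed.

End Encoding.

(** The domain on which [bitsize_state] controls the growth of the weights. *)
Definition is_instance d := exists n (e : rel 'I_n) (w : 'I_n -> rat),
  [/\ symmetric e, irreflexive e, forall v, 0 <= w v & d = enc_graph e w].

Lemma polytime_dwvc_instance : polytime is_instance dwvc.
Proof.
apply: polytime_dwvc.
have [K HK] := polytime_size (polytime_dstart is_instance).
have [L HL] : poly_bounded
  (fun m => m * (m ^ K + m * (m + 2)).+1 + m * (m + 3) + 5)%N by solve_bounded.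
exists L => d Dd j; apply: leq_trans (HL _ (dsize_ge2 d)).
case: (Dd) => n [e [w [e_sym e_irr w_ge0 Ed]]].
have nd : (n <= dsize d)%N.
  rewrite Ed /= -{1}(size_enum_ord n) -(size_map (fun x => enc_rat (w x))).
  rewrite -(enc_seqK [seq enc_rat (w x) | x <- enum 'I_n]).
  by apply: leq_trans (size_dlist _) _; rewrite enc_seqK; lia.
have Hs : (dsize (enc_weights (scaled w)) <= dsize d ^ K)%N by rewrite -(dstartE e) -Ed HK.
have -> : dstart d = enc_weights (scaled w) by rewrite Ed dstartE.
have -> : diota (dfst d) = enc_vertices (enum 'I_n) by rewrite Ed /= diota_ws.
have -> : dsnd d = enc_seq [seq enc_set [set y | e x y] | x <- enum 'I_n] by rewrite Ed.
rewrite -[Node _ _]/(enc_state (scaled w, [::])) foldl_dstep.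
set s := size _; have sn : (s <= n)%N.
  by rewrite /s size_take_min enc_seqK size_map size_enum_ord geq_minr.
apply: leq_trans (dsize_enc_state w_ge0 e_sym e_irr sn Hs) _.
by rewrite leq_add2r leq_add // leq_mul // ?ltnS leq_add // leq_mul // leq_add2r.
Qed.

Theorem theorem11 :
  exists (algo : cmd) (c k : nat),
    forall (n : nat) (e : rel 'I_n) (w : 'I_n -> rat),
      symmetric e -> irreflexive e -> (forall v : 'I_n, 0 <= w v) ->
      exists X : {set 'I_n},
        [/\ outputs_within algo (enc_graph e w) (enc_set X)
              (c * dsize (enc_graph e w) ^ k + c)%N,
            vertex_cover e X
          & weight w X <= OPT_WVC e w + OPT_CVD e w].
Proof.
have [algo [m [k algoP]]] := polytime_dwvc_instance.
exists algo, 1%N, k => n e w e_sym e_irr w_ge0.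
have [vcX optX] := reduce_final e_sym e_irr (scaled_ge0 w_ge0).
rewrite card_ord in vcX optX.
eexists; split; [| exact: vcX |].
  have [|t [s [E out _ T]]] := algoP (init (enc_graph e w)).
    by exists n, e, w.
  exists t, s; split => //; first by rewrite out dwvcE.
  by rewrite mul1n; apply: leq_trans T (leq_addr _ _).
rewrite /OPT_WVC /OPT_CVD.
case: arg_minP => [|C vcC _]; first exact: vertex_coverT.
case: arg_minP => [|M cdM _]; first exact: cluster_deletionT.
(* Multiplying by the common denominator turns the rational inequality into the integer one of
   [reduce_final], applied to an optimal [C] and an optimal [M]. *)
have d0 : 0 < (\prod_x denq (w x))%:~R :> rat by rewrite ltr0z den_gt0.
rewrite -(ler_pM2r d0) mulrDl -!weightZ_scaled -intrD ler_int.
exact: optX.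
Qed.
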